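(* Let $E$ be an $AL$-space and let $F$ be a Banach lattice whose dual $F'$ is order continuous. Then for every sequentially $uaw$-compact operator $T\colon E\to F$, the adjoint $T'\colon F'\to E'$ is sequentially $uaw$-compact.
   Context: A net $(x_\alpha)$ in a Banach lattice $G$ is $uaw$-convergent to $x$ if $|x_\alpha-x|\wedge u\to 0$ weakly for every $u\in G_+$. A bounded operator $T\colon X\to G$ from a Banach space into a Banach lattice is sequentially $uaw$-compact if for every bounded sequence $(x_n)$ in $X$, the sequence $(Tx_n)$ has a subsequence that is $uaw$-convergent in $G$. *)

(* Defs.v *)
From HB Require Import structures.
From mathcomp Require Import all_boot all_order all_algebra.
From mathcomp Require Import all_classical all_reals all_analysis.
Unset Printing Implicit Defensive.
Import Order.TTheory GRing.Theory Num.Theory.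
Import numFieldNormedType.Exports.
Local Open Scope classical_set_scope.
Local Open Scope ring_scope.

(* Raw data of an ordered normed vector space (no axioms): a carrier, a
   domain predicate (the elements that actually belong to the space),
   vector operations, norm and order.  Used uniformly for a Banach lattice
   and for its dual (realized as bounded linear functionals). *)
Record vl (R : realType) := VL {
  vcar : Type;
  vdom : vcar -> Prop;
  vadd : vcar -> vcar -> vcar;
  vopp : vcar -> vcar;
  vscale : R -> vcar -> vcar;
  vzero : vcar;
  vnorm : vcar -> R;
  vle : vcar -> vcar -> Prop }.
Arguments vcar {R}. Arguments vdom {R}. Arguments vadd {R}. Arguments vopp {R}.
Arguments vscale {R}. Arguments vzero {R}. Arguments vnorm {R}. Arguments vle {R}.

Section Generic.
Variables (R : realType) (V : vl R).

Definition bounded_lin (f : vcar V -> R) : Prop :=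
  (forall a x y, vdom V x -> vdom V y ->
     f (vadd V (vscale V a x) y) = a * f x + f y) /\
  exists C : R, forall x, vdom V x -> `|f x| <= C * vnorm V x.

Definition is_abs (x a : vcar V) : Prop :=
  vdom V a /\ vle V x a /\ vle V (vopp V x) a /\
  forall b, vdom V b -> vle V x b -> vle V (vopp V x) b -> vle V a b.

Definition is_meet (x y m : vcar V) : Prop :=
  vdom V m /\ vle V m x /\ vle V m y /\
  forall b, vdom V b -> vle V b x -> vle V b y -> vle V b m.

Definition is_inf (S : set (vcar V)) (g : vcar V) : Prop :=
  vdom V g /\ (forall s, S s -> vle V g s) /\
  forall b, vdom V b -> (forall s, S s -> vle V b s) -> vle V b g.

Definition weak_cvg0 (h : nat -> vcar V) : Prop :=
  forall phi : vcar V -> R, bounded_lin phi ->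
    (fun n => phi (h n)) @ \oo --> (0 : R).

Definition uaw_cvg (x : nat -> vcar V) (x0 : vcar V) : Prop :=
  forall u, vdom V u -> vle V (vzero V) u ->
    exists h : nat -> vcar V,
      (forall n, exists a, is_abs (vadd V (x n) (vopp V x0)) a /\
                           is_meet a u (h n)) /\
      weak_cvg0 h.

Definition order_continuous : Prop :=
  forall (I : Type) (leI : I -> I -> Prop) (x : I -> vcar V),
    inhabited I ->
    (forall i, leI i i) ->
    (forall i j k, leI i j -> leI j k -> leI i k) ->
    (forall i j, exists k, leI i k /\ leI j k) ->
    (forall i, vdom V (x i)) ->
    (forall i j, leI i j -> vle V (x j) (x i)) ->
    is_inf (range x) (vzero V) ->
    forall e : R, 0 < e -> exists i0, forall i, leI i0 i -> vnorm V (x i) < e.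

Definition dual : vl R :=
  @VL R (vcar V -> R) bounded_lin
    (fun f g x => f x + g x) (fun f x => - f x) (fun a f x => a * f x)
    (fun _ => 0)
    (fun f => sup [set `|f x| | x in [set x | vdom V x /\ vnorm V x <= 1]])
    (fun f g => forall x, vdom V x -> vle V (vzero V) x -> f x <= g x).

End Generic.

Arguments bounded_lin {R V}. Arguments is_abs {R V}. Arguments is_meet {R V}.
Arguments is_inf {R V}. Arguments weak_cvg0 {R V}. Arguments uaw_cvg {R V}.
Arguments order_continuous {R}. Arguments dual {R}.

Section Operators.
Variables (R : realType) (V W : vl R).

Definition bounded_op (T : vcar V -> vcar W) : Prop :=
  (forall x, vdom V x -> vdom W (T x)) /\
  (forall a x y, vdom V x -> vdom V y ->
     T (vadd V (vscale V a x) y) = vadd W (vscale W a (T x)) (T y)) /\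
  exists C : R, forall x, vdom V x -> vnorm W (T x) <= C * vnorm V x.

Definition seq_uaw_compact (T : vcar V -> vcar W) : Prop :=
  forall x : nat -> vcar V, (forall n, vdom V (x n)) ->
    (exists M : R, forall n, vnorm V (x n) <= M) ->
    exists (s : nat -> nat) (y : vcar W),
      (forall n, (s n < s n.+1)%N) /\ vdom W y /\
      uaw_cvg (fun n => T (x (s n))) y.

Definition adjoint (T : vcar V -> vcar W) : vcar (dual W) -> vcar (dual V) :=
  fun f x => f (T x).
End Operators.
Arguments bounded_op {R V W}. Arguments seq_uaw_compact {R V W}. Arguments adjoint {R V W}.

Record BanachLattice (R : realType) := {
  blT :> completeNormedModType R;
  ble : blT -> blT -> Prop;
  bjoin : blT -> blT -> blT;
  ble_refl : forall x, ble x x;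
  ble_trans : forall x y z, ble x y -> ble y z -> ble x z;
  ble_anti : forall x y, ble x y -> ble y x -> x = y;
  ble_add : forall x y z, ble x y -> ble (x + z) (y + z);
  ble_scale : forall (a : R) x y, 0 <= a -> ble x y -> ble (a *: x) (a *: y);
  bjoin_ubl : forall x y, ble x (bjoin x y);
  bjoin_ubr : forall x y, ble y (bjoin x y);
  bjoin_least : forall x y z, ble x z -> ble y z -> ble (bjoin x y) z;
  bl_norm_mono : forall x y, ble (bjoin x (- x)) (bjoin y (- y)) -> `|x| <= `|y|
}.

Arguments blT {R}. Arguments ble {R}. Arguments bjoin {R}.

Definition vl_of (R : realType) (E : BanachLattice R) : vl R :=
  @VL R (blT E) (fun _ => True) (fun x y => x + y) (fun x => - x)
    (fun a x => a *: x) 0 (fun x => `|x|) (ble E).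

Arguments vl_of {R}.

Definition AL_space (R : realType) (E : BanachLattice R) : Prop :=
  forall x y : blT E, ble E 0 x -> ble E 0 y -> `|x + y| = `|x| + `|y|.
Arguments AL_space {R}.

(* Main.v *)
(* Since F' is order continuous, a bounded sequence z_n with |z_n| /\ u -> 0
   weakly for all u >= 0 is weakly null: otherwise a positive functional psi
   is bounded away from 0 on a disjoint bounded sequence y_k built from
   |z_n|, and the components of psi in the bands generated by y_n, y_(n+1),
   ... decrease to 0 but not in norm.  So T maps bounded sequences to
   sequences with weakly convergent subsequences.

   Let f_n be bounded in F', f0 a weak* cluster point and h_n = T'f_n - T'f0.
   For countably many x in E we may assume f_n(Tx) -> f0(Tx).  If Phi(|h_n|)
   does not tend to 0 for some positive Phi on E', then, e being the order
   unit of E' (the norm on the cone of E), some elements +-h_(r i) - delta e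
   have finite infima that are positive somewhere on the cone: this
   is the lattice version of the fact that infinitely many sets of measure
   >= delta have a subfamily whose finite intersections have positive measure.
   Hence there are x_k in the unit ball, taken from the countable family, with
   |h_(r i)(x_k)| > delta for all i <= k.  A weak limit point y of T x_k has
   |(f_(r i) - f0)(y)| >= delta for all i, while every weak* cluster point of
   (f_(r i)) agrees with f0 on the T x_k, hence at y. *)
Require Import Defs.
From HB Require Import structures.
From mathcomp Require Import all_boot all_order all_algebra.
From mathcomp Require Import all_classical all_reals all_analysis.
From mathcomp Require Import ring lra.

Set Implicit Arguments.
Unset Strict Implicit.
Unset Printing Implicit Defensive.
Import Order.TTheory GRing.Theory Num.Theory.
Import numFieldNormedType.Exports.
Local Open Scope classical_set_scope.
Local Open Scope ring_scope.

(** * Lattice-ordered groups *)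

(** Order and join are record data rather than a structure on [G], so that the same lemmas serve a
    Banach lattice and its dual. Meets are recovered from joins. *)
Record lgroup (G : zmodType) := LGroup {
  lle : G -> G -> Prop;
  ljoin : G -> G -> G;
  lle_refl : forall x, lle x x;
  lle_trans : forall x y z, lle x y -> lle y z -> lle x z;
  lle_anti : forall x y, lle x y -> lle y x -> x = y;
  lle_addr : forall x y z, lle x y -> lle (x + z) (y + z);
  ljoin_ubl : forall x y, lle x (ljoin x y);
  ljoin_ubr : forall x y, lle y (ljoin x y);
  ljoin_least : forall x y z, lle x z -> lle y z -> lle (ljoin x y) z }.

Arguments lle : simpl never.
Arguments ljoin : simpl never.

Section LGroupTheory.
Variables (G : zmodType) (L : lgroup G).
Implicit Types x y z u v : G.

Local Notation "x =<= y" := (lle L x y) (at level 70).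
Local Notation join := (ljoin L).

Definition lmeet x y := x + y - join x y.
Definition lpos x := join x 0.
Definition labs x := join x (- x).

Lemma lle_addl x y z : x =<= y -> z + x =<= z + y.
Proof. by rewrite ![z + _]addrC; apply: lle_addr. Qed.

Lemma lle_add x y z u : x =<= y -> z =<= u -> x + z =<= y + u.
Proof. by move=> xy zu; apply: lle_trans (lle_addr z xy) (lle_addl y zu). Qed.

Lemma lle_subr x y z : x + y =<= z <-> x =<= z - y.
Proof.
split=> [/(lle_addr (- y))|/(lle_addr y)]; first by rewrite addrK.
by rewrite subrK.
Qed.

Lemma lle_subl x y z : x - y =<= z <-> x =<= z + y.
Proof. by rewrite lle_subr opprK. Qed.

Lemma lle_sub0 x y : 0 =<= y - x <-> x =<= y.
Proof. by rewrite -lle_subr add0r. Qed.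

Lemma lle_opp x y : x =<= y -> - y =<= - x.
Proof. by move=> xy; rewrite -lle_sub0 addrC opprK lle_sub0. Qed.

Lemma lle_addr0 x y : 0 =<= y -> x =<= x + y.
Proof. by move=> y0; rewrite -[X in X =<= _]addr0; apply: lle_addl. Qed.

Lemma ladd_ge0 x y : 0 =<= x -> 0 =<= y -> 0 =<= x + y.
Proof. by move=> x0 y0; rewrite -(addr0 0); apply: lle_add. Qed.

Lemma lsum_ge0 I (r : seq I) (F : I -> G) :
  (forall i, 0 =<= F i) -> 0 =<= \sum_(i <- r) F i.
Proof.
move=> F0; elim/big_ind: _ => // [|x y]; [exact: lle_refl | exact: ladd_ge0].
Qed.

Lemma ljoinDr x y z : join x y + z = join (x + z) (y + z).
Proof.
apply: lle_anti; last first.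
  by apply: ljoin_least; apply: lle_addr; [apply: ljoin_ubl | apply: ljoin_ubr].
by apply/lle_subr; apply: ljoin_least; apply/lle_subr;
  [apply: ljoin_ubl | apply: ljoin_ubr].
Qed.

Lemma ljoinC x y : join x y = join y x.
Proof.
by apply: lle_anti; apply: ljoin_least;
  (apply: ljoin_ubl || apply: ljoin_ubr).
Qed.

Lemma lmeetC x y : lmeet x y = lmeet y x.
Proof. by rewrite /lmeet ljoinC addrC [y + x]addrC addrC. Qed.

Lemma lmeet_lbl x y : lmeet x y =<= x.
Proof. by apply/lle_subl; apply: lle_addl; apply: ljoin_ubr. Qed.

Lemma lmeet_lbr x y : lmeet x y =<= y.
Proof. by rewrite lmeetC; apply: lmeet_lbl. Qed.

Lemma lmeet_greatest x y z : z =<= x -> z =<= y -> z =<= lmeet x y.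
Proof.
move=> zx zy; apply/lle_subr; rewrite addrC; apply/lle_subr.
apply: ljoin_least; apply/lle_subr; first exact: lle_addl.
by rewrite addrC; apply: lle_addr.
Qed.

Lemma lmeet_ge0 x y : 0 =<= x -> 0 =<= y -> 0 =<= lmeet x y.
Proof. exact: lmeet_greatest. Qed.

Lemma lmeet_mono x y z u : x =<= z -> y =<= u -> lmeet x y =<= lmeet z u.
Proof.
move=> xz yu; apply: lmeet_greatest.
  exact: lle_trans (lmeet_lbl _ _) xz.
exact: lle_trans (lmeet_lbr _ _) yu.
Qed.

Lemma lmeet_l x y : x =<= y -> lmeet x y = x.
Proof.
move=> xy; apply: lle_anti; first exact: lmeet_lbl.
by apply: lmeet_greatest => //; apply: lle_refl.
Qed.

Lemma ljoin_meet x y : join x y + lmeet x y = x + y.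
Proof. by rewrite /lmeet addrC subrK. Qed.

Lemma lpos_ge0 x : 0 =<= lpos x. Proof. exact: ljoin_ubr. Qed.

Lemma lle_pos x : x =<= lpos x. Proof. exact: ljoin_ubl. Qed.

Lemma lpos_mono x y : x =<= y -> lpos x =<= lpos y.
Proof.
move=> xy; apply: ljoin_least; last exact: lpos_ge0.
exact: lle_trans xy (lle_pos y).
Qed.

Lemma lpos_id x : 0 =<= x -> lpos x = x.
Proof.
move=> x0; apply: lle_anti; last exact: lle_pos.
by apply: ljoin_least => //; apply: lle_refl.
Qed.

Lemma lposN x : lpos (- x) = lpos x - x.
Proof. by rewrite /lpos ljoinDr subrr sub0r ljoinC. Qed.

Lemma lposB x : x = lpos x - lpos (- x).
Proof. by rewrite lposN opprB addrC subrK. Qed.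

Lemma lsub_meet x y : x - lmeet x y = lpos (x - y).
Proof. by rewrite /lmeet opprB addrCA opprD addNKr /lpos -(subrr y) -ljoinDr. Qed.


Lemma lmeet_posN x : lmeet (lpos x) (lpos (- x)) = 0.
Proof.
have := lsub_meet (lpos x) (lpos (- x)).
rewrite -lposB => /eqP; rewrite subr_eq -{1}[lpos x]addr0.
by move/eqP/addrI.
Qed.

Lemma labs_ge0 x : 0 =<= labs x.
Proof.
set a := labs x.
have h : - a =<= a.
  rewrite -lle_sub0 opprK -(subrr x).
  by apply: lle_add; [apply: ljoin_ubl | apply: ljoin_ubr].
have e : lpos (- a) = 0.
  by rewrite -(lmeet_posN a) lmeetC lmeet_l //; apply: lpos_mono.
by rewrite (lposB a) e subr0; apply: lpos_ge0.
Qed.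

Lemma labsE x : labs x = lpos x + lpos (- x).
Proof.
rewrite -ljoin_meet lmeet_posN addr0; apply: lle_anti; apply: ljoin_least.
- exact: lle_trans (lle_pos _) (ljoin_ubl _ _ _).
- exact: lle_trans (lle_pos _) (ljoin_ubr _ _ _).
- by apply: ljoin_least (labs_ge0 _); apply: ljoin_ubl.
- by apply: ljoin_least (labs_ge0 _); apply: ljoin_ubr.
Qed.

Lemma labs_id x : 0 =<= x -> labs x = x.
Proof.
move=> x0; rewrite labsE lpos_id // lposN lpos_id // subrr addr0.
by [].
Qed.

Lemma lmeet_addl x y z : 0 =<= x -> 0 =<= y -> 0 =<= z ->
  lmeet (x + y) z =<= lmeet x z + lmeet y z.
Proof.
move=> x0 y0 z0; set m := lmeet _ z.
have mxy : m =<= x + y by apply: lmeet_lbl.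
have mz : m =<= z by apply: lmeet_lbr.
clearbody m; have h b : 0 =<= b -> m - b =<= z.
  by move=> b0; apply/lle_subl; apply: lle_trans mz _; apply: lle_addr0.
suff : m - lmeet x z =<= lmeet y z by move/lle_subl; rewrite addrC.
apply: lmeet_greatest; last by apply: h; apply: lmeet_ge0.
apply/lle_subl; rewrite addrC; apply/lle_subl; apply: lmeet_greatest.
  exact/lle_subl.
exact: h.
Qed.

Lemma ljoin_le_add x y : 0 =<= x -> 0 =<= y -> join x y =<= x + y.
Proof.
move=> x0 y0; rewrite -ljoin_meet; apply: lle_addr0; exact: lmeet_ge0.
Qed.

Lemma lmeet_joinl x y z : 0 =<= x -> 0 =<= y -> 0 =<= z ->
  lmeet (join x y) z =<= lmeet x z + lmeet y z.
Proof.
move=> x0 y0 z0; apply: lle_trans (lmeet_addl x0 y0 z0).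
by apply: lmeet_mono; [apply: ljoin_le_add | apply: lle_refl].
Qed.

Lemma lmeet_add_le x y u v : 0 =<= u -> 0 =<= v ->
  lmeet x u + lmeet y v =<= lmeet (x + y) (u + v).
Proof.
by move=> u0 v0; apply: lmeet_greatest; apply: lle_add;
  (apply: lmeet_lbl || apply: lmeet_lbr).
Qed.

(** The two meets are disjoint, so their sum is their join, which lies below [x]. *)
Lemma lmeet_disj x u v : 0 =<= x -> 0 =<= u -> 0 =<= v -> lmeet u v = 0 ->
  lmeet x u + lmeet x v =<= lmeet x (u + v).
Proof.
move=> x0 u0 v0 uv; apply: lmeet_greatest; last first.
  by apply: lle_add; apply: lmeet_lbr.
rewrite -ljoin_meet.
have -> : lmeet (lmeet x u) (lmeet x v) = 0.
  apply: lle_anti; last by do 2?apply: lmeet_ge0.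
  by rewrite -uv; apply: lmeet_mono; apply: lmeet_lbr.
by rewrite addr0; apply: ljoin_least; apply: lmeet_lbl.
Qed.

Lemma riesz_decomposition x y z : 0 =<= x -> 0 =<= y -> 0 =<= z -> z =<= x + y ->
  exists u v, [/\ z = u + v, 0 =<= u, u =<= x, 0 =<= v & v =<= y].
Proof.
move=> x0 y0 z0 zxy; exists (lmeet z x), (z - lmeet z x); split.
- by rewrite addrC subrK.
- exact: lmeet_ge0.
- exact: lmeet_lbr.
- by apply/lle_sub0; apply: lmeet_lbl.
- rewrite lsub_meet; apply: ljoin_least => //.
  by apply/lle_subl; rewrite addrC.
Qed.

(** An upper-bound form of distributivity. The inequality [lmeet x w =<= t] reads
    [w =<= t - x + join x w]; enlarging the join to [join x (join y z)] gives one bound for both [y]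
    and [z]. *)
Lemma lmeet_join_le x y z t :
  lmeet x y =<= t -> lmeet x z =<= t -> lmeet x (join y z) =<= t.
Proof.
have key w : lmeet x w =<= t -> w =<= join y z -> w =<= t - x + join x (join y z).
  move=> /lle_subl xw wyz; have : w =<= t - x + join x w.
    by rewrite addrAC; apply/lle_subr; rewrite [w + x]addrC.
  move=> /lle_trans; apply; apply: lle_addl; apply: ljoin_least.
    exact: ljoin_ubl.
  by apply: lle_trans wyz _; apply: ljoin_ubr.
move=> xy xz; apply/lle_subl; rewrite addrC; apply/lle_subr.
rewrite addrAC; apply: ljoin_least; apply: key => //;
  [exact: ljoin_ubl | exact: ljoin_ubr].
Qed.

Lemma lmeet_pos x y : lmeet (lpos x) (lpos y) =<= lpos (lmeet x y).
Proof.
rewrite lmeetC; apply: lmeet_join_le; last first.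
  by apply: lle_trans (lmeet_lbr _ _) (lpos_ge0 _).
rewrite lmeetC; apply: lmeet_join_le; first exact: lle_pos.
by apply: lle_trans (lmeet_lbr _ _) (lpos_ge0 _).
Qed.

End LGroupTheory.

(* A transparent [lmeet] is a sum up to conversion, and rewriting with rules
   about sums would select it. *)
Global Opaque lmeet.

(** * Positive functionals on the cone *)

Section ConeFunctionals.
Variables (R : realType) (G : zmodType) (L : lgroup G).
Implicit Types x y z u v b c : G.

Local Notation "x =<= y" := (lle L x y) (at level 70).
Local Notation join := (ljoin L).
Local Notation meet := (lmeet L).
Local Notation pos := (lpos L).

(** Values off the cone are arbitrary. On the cone of a Banach lattice, homogeneity under
    nonnegative scalars follows by [cone_scale]. *)
Definition cone_functional (p : G -> R) :=
  (forall x y, 0 =<= x -> 0 =<= y -> p (x + y) = p x + p y) /\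
  (forall x, 0 =<= x -> 0 <= p x).

Section ConeFunctionalTheory.
Variables (p : G -> R) (pP : cone_functional p).

Lemma cone_mono x y : 0 =<= x -> x =<= y -> p x <= p y.
Proof.
move=> x0 xy; have yx : 0 =<= y - x by apply/lle_sub0.
rewrite -[y](subrK x) addrC pP.1 // lerDl; exact: pP.2.
Qed.

Lemma cone0 : p 0 = 0.
Proof.
have := pP.1 _ _ (lle_refl L 0) (lle_refl L 0).
by rewrite addr0 => /eqP; rewrite -subr_eq0 opprD addNKr oppr_eq0 => /eqP.
Qed.

Lemma cone_pos_gt0 x : 0 < p (pos x) -> ~ x =<= 0.
Proof.
move=> + x0; have -> : pos x = 0; last by rewrite cone0 ltxx.
apply: lle_anti (lpos_ge0 _ _); apply: ljoin_least => //; exact: lle_refl.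
Qed.

Lemma cone_joinE x y : 0 =<= x -> 0 =<= y ->
  p (join x y) = p x + p y - p (meet x y).
Proof.
move=> x0 y0; rewrite -pP.1 // -(ljoin_meet L x y) pP.1 ?addrK //.
  exact: lle_trans x0 (ljoin_ubl _ _ _).
exact: lmeet_ge0.
Qed.

End ConeFunctionalTheory.

(** * Positive parts of additive functionals *)

Section RieszKantorovich.
Variables (phi : G -> R).
Hypothesis phiD : forall x y, phi (x + y) = phi x + phi y.
Hypothesis phi_ub : forall b, 0 =<= b ->
  exists M, forall c, 0 =<= c -> c =<= b -> phi c <= M.

Definition rk b := sup [set phi c | c in [set c | 0 =<= c /\ c =<= b]].

Lemma rk_ub b c : 0 =<= c -> c =<= b -> phi c <= rk b.
Proof.
move=> c0 cb; apply: ub_le_sup; last by exists c.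
have [M hM] := phi_ub (lle_trans c0 cb).
by exists M => _ [d [d0 db] <-]; apply: hM.
Qed.

Lemma rk_least b M : 0 =<= b ->
  (forall c, 0 =<= c -> c =<= b -> phi c <= M) -> rk b <= M.
Proof.
move=> b0 h; apply: ge_sup; last by move=> _ [d [d0 db] <-]; apply: h.
by exists (phi 0); exists 0 => //; split => //; apply: lle_refl.
Qed.

(** An element below [x + y] splits by Riesz decomposition into elements below [x] and [y], which
    gives subadditivity; adding elements gives the converse. *)
Lemma rk_cone : cone_functional rk.
Proof.
have phi0 : phi 0 = 0.
  have := phiD 0 0.
  by rewrite addr0 => /eqP; rewrite -subr_eq0 opprD addNKr oppr_eq0 => /eqP.
split; last first.
  by move=> x x0; rewrite -phi0; apply: rk_ub => //; apply: lle_refl.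
move=> x y x0 y0; have xy0 := ladd_ge0 x0 y0.
apply/eqP; rewrite eq_le; apply/andP; split.
  apply: rk_least => // c c0 /(riesz_decomposition x0 y0 c0)[u [v [-> *]]].
  by rewrite phiD lerD // rk_ub.
rewrite -lerBrDr; apply: rk_least => // c c0 cx.
rewrite lerBrDr -lerBrDl; apply: rk_least => // d d0 dy.
rewrite lerBrDl -phiD; apply: rk_ub; first exact: ladd_ge0.
exact: lle_add.
Qed.

End RieszKantorovich.

(** * Finite infima in a sequence with large values *)

Section Recurrence.
Variables (p : G -> R) (pP : cone_functional p).
Variables (c : nat -> G) (c_ge0 : forall n, 0 =<= c n).

Definition recurrent d := exists2 eta : R, 0 < eta &
  forall N, exists2 n, (N <= n)%N & eta <= p (meet d (c n)).

(* Otherwise some of the [d /\ c n] are almost disjoint, with values of [p]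
   bounded below, and their joins would be unbounded for [p] below [d]. *)
Lemma recurrent_meet d N : 0 =<= d -> recurrent d ->
  exists2 n, (N <= n)%N & recurrent (meet d (c n)).
Proof.
move=> d0 [eta eta0 dP]; apply: contrapT => hN.
(* The negated goal: under [p], the overlaps of [meet d (c n)] with later [c m] tend to 0. *)
have fading n : (N <= n)%N -> forall e, 0 < e ->
    exists N', forall m, (N' <= m)%N -> p (meet (meet d (c n)) (c m)) < e.
  move=> Nn e e0; apply: contrapT => h; apply: hN; exists n => //.
  exists e => // N'; apply: contrapT => h'; apply: h; exists N' => m N'm.
  by rewrite ltNge; apply/negP => ?; apply: h'; exists m.
(* Each of [K] joins raises the value by at least [eta / 2]: the new meet contributes [eta], and its
   overlap with [D] costs less than [eta / 2], because [D] is almost disjoint from late [c m]. *)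
have large K : exists D, [/\ 0 =<= D, D =<= d, K%:R * (eta / 2) <= p D &
    forall e, 0 < e ->
      exists N', forall m, (N' <= m)%N -> p (meet D (c m)) < e].
  elim: K => [|K [D [D0 Dd pD Dfad]]].
    exists 0; split => //; [exact: lle_refl | by rewrite mul0r cone0 |].
    move=> e e0; exists 0%N => m _.
    by rewrite lmeet_l // (cone0 pP).
  have e20 : 0 < eta / 2 by rewrite divr_gt0.
  have [N1 hN1] := Dfad _ e20.
  have [n nN hn] := dP (maxn N N1).
  have dn0 : 0 =<= meet d (c n) by apply: lmeet_ge0.
  exists (join D (meet d (c n))); split.
  - exact: lle_trans D0 (ljoin_ubl _ _ _).
  - by apply: ljoin_least => //; apply: lmeet_lbl.
  - rewrite (cone_joinE pP) // -natr1 mulrDl mul1r.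
    have : p (meet D (meet d (c n))) <= p (meet D (c n)).
      apply: (cone_mono pP); first exact: lmeet_ge0.
      by apply: lmeet_mono; [apply: lle_refl | apply: lmeet_lbr].
    have := hN1 n (leq_trans (leq_maxr _ _) nN).
    move: pD hn; set X := K%:R * _; lra.
  - move=> e e0; have e2 : 0 < e / 2 by rewrite divr_gt0.
    have [N2 hN2] := Dfad _ e2.
    have [N3 hN3] := fading n (leq_trans (leq_maxl _ _) nN) _ e2.
    exists (maxn N2 N3) => m; rewrite geq_max => /andP[/hN2 h2 /hN3 h3].
    rewrite (splitr e); apply: le_lt_trans (ltrD h2 h3).
    rewrite -pP.1; [|exact: lmeet_ge0|exact: lmeet_ge0].
    apply: (cone_mono pP); last exact: lmeet_joinl.
    apply: lmeet_ge0 => //; exact: lle_trans D0 (ljoin_ubl _ _ _).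
(* For this [K], the product [K * (eta / 2)] exceeds [p d], although [D =<= d]. *)
pose K := Num.bound (p d / (eta / 2)).
have [D [D0 Dd + _]] := large K.
apply/negP; rewrite -ltNge; apply: le_lt_trans (cone_mono pP D0 Dd) _.
rewrite -ltr_pdivrMr ?divr_gt0 //; apply: archi_boundP.
by rewrite divr_ge0 ?divr_ge0 ?(ltW eta0) //; apply: pP.2.
Qed.

(** Iterating [recurrent_meet] gives decreasing elements, on each of which [p] is positive because
    the element is still recurrent. *)
Lemma recurrent_chain d : 0 =<= d -> recurrent d ->
  exists (s : nat -> nat) (m : nat -> G), (forall k, (s k < s k.+1)%N) /\
  forall k, [/\ 0 =<= m k, 0 < p (m k), m k.+1 =<= m k & m k =<= c (s k)].
Proof.
move=> d0 dP.
pose ok (q : nat * G) := 0 =<= q.2 /\ recurrent q.2.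
have step q : exists q' : nat * G, ok q ->
    [/\ (q.1 < q'.1)%N, q'.2 = meet q.2 (c q'.1) & ok q'].
  have [[q0 /recurrent_meet h]|] := pselect (ok q); last by exists q.
  have [n qn hn] := h q.1.+1 q0.
  by exists (n, meet q.2 (c n)) => _; split => //; split => //; apply: lmeet_ge0.
have [next nextP] := choice step.
pose st k := iter k next (0%N, d).
have stP k : ok (st k) by elim: k => [//|k /nextP[]].
(* The shift by one skips the initial pair [(0, d)], which involves no [c n] yet. *)
exists (fun k => (st k.+1).1), (fun k => (st k.+1).2); split.
  by move=> k; have [] := nextP _ (stP k.+1).
move=> k; have [_ e _] := nextP _ (stP k).
have [_ e' _] := nextP _ (stP k.+1).
have [q0 [eta eta0 /(_ 0%N)[n _ hn]]] := stP k.+1.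
split=> //.
- apply: lt_le_trans eta0 (le_trans hn _).
  by apply: (cone_mono pP); [exact: lmeet_ge0 | exact: lmeet_lbl].
- rewrite [X in X =<= _]e'; exact: lmeet_lbl.
- rewrite [X in X =<= _]e; exact: lmeet_lbr.
Qed.

End Recurrence.

(** The chain is built from the positive parts, starting at their common bound [b]. By [lmeet_pos],
    [m k] lies below the positive part of a finite infimum of the [g (s i)], and [0 < p (m k)] keeps
    that infimum from lying below 0. *)
Lemma infima_subsequence (p : G -> R) (g : nat -> G) b (delta : R) :
  cone_functional p -> 0 < delta -> (forall n, pos (g n) =<= b) ->
  (forall N, exists2 n, (N <= n)%N & delta <= p (pos (g n))) ->
  exists s : nat -> nat, (forall k, (s k < s k.+1)%N) /\
  forall k, exists2 d, ~ d =<= 0 & forall i, (i <= k)%N -> d =<= g (s i).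
Proof.
move=> pP delta0 gb gP.
have b0 : 0 =<= b by apply: lle_trans (gb 0%N); apply: lpos_ge0.
have bP : recurrent p (fun n => pos (g n)) b.
  exists delta => // N; have [n Nn hn] := gP N; exists n => //.
  by rewrite lmeetC lmeet_l.
have [s [m [sS mP]]] := recurrent_chain pP (fun n => lpos_ge0 L (g n)) b0 bP.
exists s; split=> // k.
suff [d md dg] : exists2 d, m k =<= pos d & forall i, (i <= k)%N -> d =<= g (s i).
  exists d => //; apply: (cone_pos_gt0 pP).
  by have [m0 mk _ _] := mP k; apply: lt_le_trans mk (cone_mono pP m0 md).
elim: k => [|k [d md dg]].
  exists (g (s 0%N)); first by have [] := mP 0%N.
  by case=> // _; apply: lle_refl.
exists (meet d (g (s k.+1))).
  apply: lle_trans (lmeet_pos _ _ _); apply: lmeet_greatest.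
    by have [_ _ h _] := mP k; apply: lle_trans h md.
  by have [] := mP k.+1.
move=> i; rewrite leq_eqVlt => /orP[/eqP->|ik]; first exact: lmeet_lbr.
exact: lle_trans (lmeet_lbl _ _ _) (dg i ik).
Qed.

End ConeFunctionals.

(** * Components of functionals in bands *)

Section Band.
Variables (R : realType) (G : zmodType) (L : lgroup G).
Implicit Types x y z u v : G.

Local Notation "x =<= y" := (lle L x y) (at level 70).
Local Notation meet := (lmeet L).

Lemma lmulrn_ge0 x n : 0 =<= x -> 0 =<= x *+ n.
Proof.
move=> x0; elim: n => [|n IH]; first exact: lle_refl.
by rewrite mulrS; apply: ladd_ge0.
Qed.

Lemma lle_mulrn2r x y n : x =<= y -> x *+ n =<= y *+ n.
Proof.
move=> xy; elim: n => [|n IH]; first exact: lle_refl.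
by rewrite !mulrS; apply: lle_add.
Qed.

Lemma lle_mulrn2l x m n : 0 =<= x -> (m <= n)%N -> x *+ m =<= x *+ n.
Proof.
by move=> x0 /subnKC<-; rewrite mulrnDr; apply: lle_addr0; apply: lmulrn_ge0.
Qed.

Lemma disjoint_add x y z : 0 =<= x -> 0 =<= y -> 0 =<= z ->
  meet x z = 0 -> meet y z = 0 -> meet (x + y) z = 0.
Proof.
move=> x0 y0 z0 xz yz; apply: lle_anti; last first.
  by apply: lmeet_ge0 => //; apply: ladd_ge0.
by apply: lle_trans (lmeet_addl x0 y0 z0) _; rewrite xz yz addr0; apply: lle_refl.
Qed.

Lemma disjoint0 z : 0 =<= z -> meet 0 z = 0.
Proof. exact: lmeet_l. Qed.

Lemma disjoint_mulrn x z n : 0 =<= x -> 0 =<= z -> meet x z = 0 ->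
  meet (x *+ n) z = 0.
Proof.
move=> x0 z0 xz; elim: n => [|n IH]; first exact: disjoint0.
by rewrite mulrS; apply: disjoint_add => //; apply: lmulrn_ge0.
Qed.

Lemma disjoint_sum (I : eqType) (r : seq I) (F : I -> G) z : 0 =<= z ->
  (forall i, 0 =<= F i) -> (forall i, i \in r -> meet (F i) z = 0) ->
  meet (\sum_(i <- r) F i) z = 0.
Proof.
move=> z0 F0 Fz; rewrite big_seq.
suff [] : 0 =<= \sum_(i <- r | i \in r) F i /\
    meet (\sum_(i <- r | i \in r) F i) z = 0 by [].
elim/big_ind: _ => [|x y [x0 xz] [y0 yz]|i ir].
- by split; [apply: lle_refl | apply: disjoint0].
- by split; [apply: ladd_ge0 | apply: disjoint_add].
- by split => //; apply: Fz.
Qed.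

Section BandComponent.
Variables (p : G -> R) (pP : cone_functional L p).
Variables (v : nat -> G) (v_ge0 : forall j, 0 =<= v j).
Hypothesis v_mono : forall i j, (i <= j)%N -> v i =<= v j.
Hypothesis v_double : forall j, v j + v j =<= v j.+1.

(* The component of [p] in the band generated by the [v j]. *)
Definition band x := sup (range (fun j => p (meet x (v j)))).

Lemma band_ub x j : 0 =<= x -> p (meet x (v j)) <= band x.
Proof.
move=> x0; apply: ub_le_sup; last by exists j.
exists (p x) => _ [i _ <-]; apply: (cone_mono pP); first exact: lmeet_ge0.
exact: lmeet_lbl.
Qed.

Lemma band_least x (M : R) : (forall j, p (meet x (v j)) <= M) -> band x <= M.
Proof.
move=> h; apply: ge_sup; last by move=> _ [i _ <-].
by exists (p (meet x (v 0%N))), 0%N.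
Qed.

Lemma band_le x : 0 =<= x -> band x <= p x.
Proof.
move=> x0; apply: band_least => j; apply: (cone_mono pP); first exact: lmeet_ge0.
exact: lmeet_lbl.
Qed.

(** Superadditivity requires a term of the sequence above [v i + v j]; monotonicity and [v_double]
    supply [v (maxn i j).+1]. *)
Lemma band_cone : cone_functional L band.
Proof.
split=> [x y x0 y0|x x0]; last first.
  by apply: le_trans (band_ub 0%N x0); apply: pP.2; apply: lmeet_ge0.
have xy0 := ladd_ge0 x0 y0.
apply/eqP; rewrite eq_le; apply/andP; split.
  apply: band_least => j; apply: le_trans (lerD (band_ub j x0) (band_ub j y0)).
  rewrite -pP.1; [|exact: lmeet_ge0|exact: lmeet_ge0].
  by apply: (cone_mono pP); [exact: lmeet_ge0 | exact: lmeet_addl].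
rewrite -lerBrDr; apply: band_least => i.
rewrite lerBrDr -lerBrDl; apply: band_least => j.
rewrite lerBrDl; apply: le_trans (band_ub (maxn i j).+1 xy0).
rewrite -pP.1; [|exact: lmeet_ge0|exact: lmeet_ge0].
apply: (cone_mono pP); first by apply: ladd_ge0; apply: lmeet_ge0.
apply: lle_trans (lmeet_add_le _ _ (v_ge0 i) (v_ge0 j)) _.
apply: lmeet_mono; first exact: lle_refl.
apply: lle_trans (v_double _); apply: lle_add; apply: v_mono;
  [exact: leq_maxl | exact: leq_maxr].
Qed.

End BandComponent.

(** * Bands generated by the tails of a disjoint sequence *)

Section DisjointTail.
Variables (p : G -> R) (pP : cone_functional L p).
Variables (y : nat -> G) (y_ge0 : forall n, 0 =<= y n).
Hypothesis y_disj : forall m n, (m < n)%N -> meet (y m) (y n) = 0.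

(** Growing multiples of growing sums generate the band of the tail from [n] on. The factor [2 ^ j]
    provides the doubling that [band_cone] requires. *)
Definition tail_sum n j := (\sum_(n <= k < j) y k) *+ 2 ^ j.
Definition tail n := band p (tail_sum n).

Let sum_ge0 m n : 0 =<= \sum_(m <= k < n) y k.
Proof. exact: lsum_ge0. Qed.

Lemma tail_sum_ge0 n j : 0 =<= tail_sum n j.
Proof. exact/lmulrn_ge0/sum_ge0. Qed.

Lemma tail_sum_mono n i j : (i <= j)%N -> tail_sum n i =<= tail_sum n j.
Proof.
move=> ij; apply: lle_trans (lle_mulrn2l (sum_ge0 _ _) _) _.
  exact: leq_pexp2l ij.
apply: lle_mulrn2r; have [ni|/ltnW ni] := leqP n i.
  by rewrite (big_cat_nat ni ij); apply: lle_addr0.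
by rewrite big_geq.
Qed.

Lemma tail_sum_double n j : tail_sum n j + tail_sum n j =<= tail_sum n j.+1.
Proof.
rewrite -mulr2n -mulrnA -expnSr; apply: lle_mulrn2r.
have [nj|/ltnW nj] := leqP n j; first by rewrite big_nat_recr //; apply: lle_addr0.
by rewrite big_geq.
Qed.

Lemma tail_sum_anti m n j : (m <= n)%N -> tail_sum n j =<= tail_sum m j.
Proof.
move=> mn; apply: lle_mulrn2r; have [nj|/ltnW nj] := leqP n j.
  by rewrite (big_cat_nat mn nj) /= addrC; apply: lle_addr0.
by rewrite big_geq.
Qed.

Lemma tail_cone n : cone_functional L (tail n).
Proof.
exact (band_cone pP (tail_sum_ge0 n) (tail_sum_mono n) (tail_sum_double n)).
Qed.

Lemma tail_anti m n x : 0 =<= x -> (m <= n)%N -> tail n x <= tail m x.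
Proof.
move=> x0 mn; apply: band_least => j.
apply: le_trans (band_ub pP (tail_sum_ge0 m) j x0).
apply: (cone_mono pP); first by apply: lmeet_ge0 => //; apply: tail_sum_ge0.
by apply: lmeet_mono; [apply: lle_refl | apply: tail_sum_anti].
Qed.

Lemma tail_head n : p (y n) <= tail n (y n).
Proof.
apply: le_trans (band_ub pP (tail_sum_ge0 n) n.+1 (y_ge0 n)).
rewrite lmeet_l // /tail_sum big_nat1 -[X in X =<= _]mulr1n.
by apply: lle_mulrn2l => //; rewrite expn_gt0.
Qed.

Lemma tail_sum_disj i n j : (i <= n)%N -> meet (tail_sum 0 i) (tail_sum n j) = 0.
Proof.
move=> iN; apply: disjoint_mulrn => //; first exact: tail_sum_ge0.
apply: disjoint_sum => //; first exact: tail_sum_ge0.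
move=> k; rewrite mem_index_iota /= => ki; rewrite lmeetC.
apply: disjoint_mulrn => //; apply: disjoint_sum => // l.
rewrite mem_index_iota => /andP[nl _]; rewrite lmeetC; apply: y_disj.
exact: leq_trans ki (leq_trans iN nl).
Qed.

(** Let [i] be such that [p (meet x (tail_sum 0 i))] is within [e] of [tail 0 x]. The terms from [i]
    on are disjoint from [tail_sum 0 i], so [tail i x] fits into the remaining gap. *)
Lemma tail_vanish x (e : R) : 0 =<= x -> 0 < e -> exists n, tail n x < e.
Proof.
move=> x0 e0.
have [|_ [i _ <-] hi] :=
  @sup_adherent _ (range (fun j => p (meet x (tail_sum 0 j)))) _ e0.
  split; first by exists (p (meet x (tail_sum 0 0))), 0%N.
  exists (p x) => _ [j _ <-]; apply: (cone_mono pP); last exact: lmeet_lbl.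
  by apply: lmeet_ge0 => //; apply: tail_sum_ge0.
exists i; apply: (@le_lt_trans _ _ (tail 0 x - p (meet x (tail_sum 0 i)))); last first.
  by rewrite ltrBlDl -ltrBlDr.
apply: band_least => j; rewrite lerBrDl.
have t0 := tail_sum_ge0.
apply: le_trans (band_ub pP (t0 0%N) (maxn i j).+1 x0).
rewrite -pP.1; try exact: lmeet_ge0.
apply: (cone_mono pP); first by apply: ladd_ge0; apply: lmeet_ge0.
apply: lle_trans (lmeet_disj x0 (t0 _ _) (t0 _ _) (tail_sum_disj _ (leqnn i))) _.
apply: lmeet_mono; first exact: lle_refl.
apply: lle_trans (tail_sum_double _ _); apply: lle_add.
  by apply: tail_sum_mono; apply: leq_maxl.
apply: lle_trans (tail_sum_anti _ (leq0n i)) _.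
by apply: tail_sum_mono; apply: leq_maxr.
Qed.

End DisjointTail.
End Band.

(** * Banach lattices and their duals *)

Definition bl_lgroup (R : realType) (E : BanachLattice R) : lgroup (blT E) :=
  LGroup (@ble_refl _ E) (@ble_trans _ E) (@ble_anti _ E) (@ble_add _ E)
    (@bjoin_ubl _ E) (@bjoin_ubr _ E) (@bjoin_least _ E).

Section BanachLatticeTheory.
Variables (R : realType) (E : BanachLattice R).
Implicit Types (x y : blT E) (p : blT E -> R).

Local Notation L := (bl_lgroup E).
Local Notation "x =<= y" := (lle L x y) (at level 70).
Local Notation join := (ljoin L).
Local Notation meet := (lmeet L).
Local Notation pos := (lpos L).
Local Notation abs := (labs L).
Local Notation blin := (@bounded_lin R (vl_of E)).
Local Notation dnorm := (@vnorm R (dual (vl_of E))).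

Lemma lle_scale (a : R) x y : 0 <= a -> x =<= y -> a *: x =<= a *: y.
Proof. exact: ble_scale. Qed.

Lemma lscale_ge0 (a : R) x : 0 <= a -> 0 =<= x -> 0 =<= a *: x.
Proof. by move=> a0 /(lle_scale a0); rewrite scaler0. Qed.

Lemma lle_scalel (a b : R) x : a <= b -> 0 =<= x -> a *: x =<= b *: x.
Proof.
move=> ab x0; apply/lle_sub0; rewrite -scalerBl.
by apply: lscale_ge0 => //; rewrite subr_ge0.
Qed.

Lemma norm_labs x : `|abs x| = `|x|.
Proof.
have h : abs (abs x) = abs x by rewrite labs_id //; apply: labs_ge0.
apply/eqP; rewrite eq_le; apply/andP; split; apply: bl_norm_mono.
  by change (abs (abs x) =<= abs x); rewrite h; apply: lle_refl.
by change (abs x =<= abs (abs x)); rewrite h; apply: lle_refl.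
Qed.

Lemma norm_mono x y : 0 =<= x -> x =<= y -> `|x| <= `|y|.
Proof.
move=> x0 xy; apply: bl_norm_mono; change (abs x =<= abs y).
by rewrite !labs_id //; apply: lle_trans xy.
Qed.

Lemma norm_pos x : `|pos x| <= `|x|.
Proof.
rewrite -[leRHS]norm_labs; apply: norm_mono; first exact: lpos_ge0.
by apply: ljoin_least (labs_ge0 _ _); apply: ljoin_ubl.
Qed.

(** Additivity gives natural multiples, monotonicity brackets the real ones, and the Archimedean
    property removes the error. *)
Lemma cone_scale p (a : R) x : cone_functional L p -> 0 <= a -> 0 =<= x ->
  p (a *: x) = a * p x.
Proof.
move=> pP a0 x0.
have pn n y : 0 =<= y -> p (n%:R *: y) = n%:R * p y.
  move=> y0; elim: n => [|n IH]; first by rewrite scale0r mul0r (cone0 pP).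
  rewrite -natr1 scalerDl scale1r pP.1 ?IH ?mulrDl ?mul1r //.
  exact: lscale_ge0.
(* For a natural [m] with [m <= n * a < m + 1], both [n * p (a *: x)] and [n * a * p x] lie between
   [m * p x] and [(m + 1) * p x]. *)
have bnd n : n%:R * `|p (a *: x) - a * p x| <= p x.
  have na0 : 0 <= n%:R * a by rewrite mulr_ge0.
  have /andP[lo hi] := truncn_itv na0.
  have ax0 := lscale_ge0 a0 x0.
  have := cone_mono pP (lscale_ge0 (ler0n _ _) x0) (lle_scalel lo x0).
  have := cone_mono pP (lscale_ge0 na0 x0) (lle_scalel (ltW hi) x0).
  rewrite -scalerA !pn //.
  have px := pP.2 _ x0.
  move: lo hi; rewrite -natr1; set m : R := _%:R => lo hi h1 h2.
  rewrite -[X in X * `|_|]normr_nat -normrM ler_norml; apply/andP; split; nra.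
apply/eqP; rewrite -subr_eq0 -normr_le0 leNgt; apply/negP => d0.
have := archi_boundP (divr_ge0 (pP.2 _ x0) (ltW d0)).
by rewrite ltr_pdivrMr // ltNge bnd.
Qed.

Definition cone_ext p x := p (pos x) - p (pos (- x)).

Lemma cone_extE p x : cone_functional L p -> 0 =<= x -> cone_ext p x = p x.
Proof.
move=> pP x0; rewrite /cone_ext lposN lpos_id // subrr (cone0 pP) subr0.
by [].
Qed.

(** The extension does not depend on how an element is written as a difference of positive ones; its
    additivity follows from this. *)
Lemma cone_ext_sub p x y : cone_functional L p -> 0 =<= x -> 0 =<= y ->
  cone_ext p (x - y) = p x - p y.
Proof.
move=> pP x0 y0; rewrite /cone_ext; apply/eqP.
rewrite subr_eq addrAC eq_sym subr_eq -!pP.1 //; try exact: lpos_ge0.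
by rewrite lposN opprB addrC addrA subrK.
Qed.

Lemma cone_ext_bounded_lin p (C : R) : cone_functional L p ->
  (forall x, 0 =<= x -> p x <= C * `|x|) -> blin (cone_ext p).
Proof.
move=> pP pC.
have eN x : cone_ext p (- x) = - cone_ext p x.
  by rewrite /cone_ext opprK opprB.
have eZ (a : R) x : 0 <= a -> cone_ext p (a *: x) = a * cone_ext p x.
  move=> a0; rewrite {1}(lposB L x) scalerBr cone_ext_sub //;
    try (apply: lscale_ge0 => //; exact: lpos_ge0).
  rewrite !cone_scale //; try exact: lpos_ge0.
  by rewrite -mulrBr.
split=> [a x y _ _ /=|].
  have eD u v : cone_ext p (u + v) = cone_ext p u + cone_ext p v.
    rewrite {1}(lposB L u) {1}(lposB L v) addrACA -opprD cone_ext_sub //;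
      try (apply: ladd_ge0; exact: lpos_ge0).
    rewrite (pP.1 (pos u) (pos v)) ?(pP.1 (pos (- u)) (pos (- v))) //;
      try exact: lpos_ge0.
    by rewrite opprD addrACA.
  rewrite eD; congr (_ + _); have [/eZ//|a0] := leP 0 a.
  by rewrite -[a]opprK scaleNr eN eZ ?mulNr // oppr_ge0 ltW.
exists C => x _ /=.
have C0 y : 0 =<= y -> 0 <= C * `|y|.
  by move=> y0; apply: le_trans (pC _ y0); apply: pP.2.
have h1 := pC _ (lpos_ge0 L x); have h2 := pC _ (lpos_ge0 L (- x)).
have i1 := pP.2 _ (lpos_ge0 L x); have i2 := pP.2 _ (lpos_ge0 L (- x)).
have hx : 0 <= C * `|x| by rewrite -norm_labs; apply: C0; apply: labs_ge0.
(* A negative [C] reverses the comparison of norms, but then the left side is nonpositive and [hx]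
   makes the right side nonnegative. *)
have np y : `|y| = `|x| -> C * `|pos y| <= C * `|x|.
  move=> yx; have [Cp|Cn] := leP 0 C.
    by rewrite ler_wpM2l // -yx; apply: norm_pos.
  apply: le_trans hx; rewrite mulr_le0_ge0 //; exact: ltW.
have j1 := np x erefl; have j2 := np (- x) (normrN x).
rewrite /cone_ext ler_norml; apply/andP; split; lra.
Qed.

Section BoundedLinear.
Variables (f : blT E -> R) (fP : blin f).

Lemma blin_linear a x y : f (a *: x + y) = a * f x + f y.
Proof. exact: fP.1. Qed.

Lemma blinD x y : f (x + y) = f x + f y.
Proof. by rewrite -[x]scale1r blin_linear mul1r scale1r. Qed.

Lemma blin0 : f 0 = 0.
Proof.
by have /eqP := blinD 0 0; rewrite addr0 -subr_eq0 opprD addNKr oppr_eq0 => /eqP.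
Qed.

Lemma blinZ a x : f (a *: x) = a * f x.
Proof. by rewrite -[a *: x]addr0 blin_linear blin0 addr0. Qed.

Lemma blinN x : f (- x) = - f x.
Proof. by rewrite -scaleN1r blinZ mulN1r. Qed.

Lemma blinB x y : f (x - y) = f x - f y.
Proof. by rewrite blinD blinN. Qed.

Lemma blin_bound : exists2 C : R, 0 <= C & forall x, `|f x| <= C * `|x|.
Proof.
have [C hC] := fP.2; exists `|C| => // x.
by apply: le_trans (hC x I) _; rewrite ler_wpM2r //= ler_norm.
Qed.

Lemma dual_norm_ball x : `|x| <= 1 -> `|f x| <= dnorm f.
Proof.
move=> x1; apply: ub_le_sup; last by exists x.
have [C C0 hC] := blin_bound; exists C => _ [y [_ /= y1] <-].
by apply: le_trans (hC y) _; rewrite ler_piMr.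
Qed.

Lemma dual_norm_ge0 : 0 <= dnorm f.
Proof. by rewrite (le_trans (normr_ge0 (f 0))) // dual_norm_ball // normr0. Qed.

Lemma dual_norm_ge x : `|f x| <= dnorm f * `|x|.
Proof.
have [->|x0] := eqVneq x 0; first by rewrite blin0 !normr0 mulr0.
have nx : 0 < `|x| by rewrite normr_gt0.
rewrite -ler_pdivrMr //.
have -> : `|f x| / `|x| = `|f (`|x|^-1 *: x)|.
  by rewrite blinZ normrM normfV normr_id mulrC.
by apply: dual_norm_ball; rewrite normrZ normfV normr_id mulVf ?gt_eqF.
Qed.

End BoundedLinear.

Lemma dual_norm_le f (C : R) : 0 <= C -> (forall x, `|f x| <= C * `|x|) ->
  dnorm f <= C.
Proof.
move=> C0 hC; apply: ge_sup.
  by exists `|f 0|, 0 => //; split => //=; rewrite normr0.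
move=> _ [y [_ /= y1] <-]; apply: le_trans (hC y) _.
by rewrite ler_piMr.
Qed.

Lemma blin_opp f : blin f -> blin (fun x => - f x).
Proof.
move=> fP; split=> [a x y _ _ /=|].
  by rewrite blin_linear // opprD mulrN.
by have [C C0 hC] := blin_bound fP; exists C => x _; rewrite normrN; apply: hC.
Qed.

Lemma blin_add f g : blin f -> blin g -> blin (fun x => f x + g x).
Proof.
move=> fP gP; split=> [a x y _ _ /=|].
  by rewrite !blin_linear // mulrDr addrACA.
have [C C0 hC] := blin_bound fP; have [D D0 hD] := blin_bound gP.
exists (C + D) => x _ /=; apply: le_trans (ler_normD _ _) _.
by rewrite mulrDl lerD.
Qed.

Lemma blin_zero : blin (fun=> 0).
Proof.
split=> [a x y _ _ /=|]; first by rewrite mulr0 addr0.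
by exists 0 => x _; rewrite normr0 mul0r.
Qed.

Section PositivePart.
Variables (f : blT E -> R) (fP : blin f).

Lemma blin_ub x : 0 =<= x ->
  exists M, forall c, 0 =<= c -> c =<= x -> f c <= M.
Proof.
move=> x0; have [C C0 hC] := blin_bound fP; exists (C * `|x|) => c c0 cx.
apply: le_trans (ler_norm _) (le_trans (hC c) _).
by rewrite ler_wpM2l // norm_mono.
Qed.

Definition blin_pos := cone_ext (rk L f).

Let rkP : cone_functional L (rk L f).
Proof. exact: rk_cone (blinD fP) blin_ub. Qed.

Lemma blin_pos_bounded_lin : blin blin_pos.
Proof.
have [C C0 hC] := blin_bound fP.
apply: (@cone_ext_bounded_lin _ C rkP) => x x0; apply: rk_least => // c c0 cx.
apply: le_trans (ler_norm _) (le_trans (hC c) _).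
by rewrite ler_wpM2l // norm_mono.
Qed.

Lemma blin_pos_ge0 x : 0 =<= x -> 0 <= blin_pos x.
Proof. by move=> x0; rewrite /blin_pos cone_extE //; apply: rkP.2. Qed.

Lemma blin_pos_ub x : 0 =<= x -> f x <= blin_pos x.
Proof.
move=> x0; rewrite /blin_pos cone_extE //; apply: (rk_ub blin_ub) => //.
exact: lle_refl.
Qed.

Lemma blin_pos_least g x : blin g -> 0 =<= x ->
  (forall y, 0 =<= y -> 0 <= g y) -> (forall y, 0 =<= y -> f y <= g y) ->
  blin_pos x <= g x.
Proof.
move=> gP x0 g0 fg; rewrite /blin_pos cone_extE //; apply: rk_least => // c c0 cx.
apply: le_trans (fg _ c0) _; rewrite -subr_ge0 -(blinB gP); apply: g0.
exact/lle_sub0.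
Qed.

End PositivePart.

Lemma blin_ext f g : blin f -> blin g ->
  (forall x, 0 =<= x -> f x = g x) -> f = g.
Proof.
move=> fP gP fg; apply/funext => x; rewrite (lposB L x) !blinB //.
by rewrite !fg //; apply: lpos_ge0.
Qed.

End BanachLatticeTheory.

(** The carrier of [dual] consists of all functions, with boundedness as a predicate. Bundling the
    predicate yields a group to which the theory of [lgroup] applies. *)
Record dualT (R : realType) (E : BanachLattice R) := DualT {
  dfun :> blT E -> R;
  dfunP : @bounded_lin R (vl_of E) dfun }.

(** * The dual as a lattice-ordered group *)

Section DualGroup.
Variables (R : realType) (E : BanachLattice R).
Local Notation D := (dualT E).
Implicit Types f g h : D.

Lemma dualT_eq f g : dfun f = dfun g -> f = g.
Proof.
case: f g => [f fP] [g gP] /= fg; subst g; congr DualT; exact: Prop_irrelevance.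
Qed.

Definition dual0 : D := DualT (blin_zero E).
Definition dual_add f g : D := DualT (blin_add (dfunP f) (dfunP g)).
Definition dual_opp f : D := DualT (blin_opp (dfunP f)).

Lemma dual_addA : associative dual_add.
Proof. by move=> f g h; apply/dualT_eq/funext => x /=; rewrite addrA. Qed.
Lemma dual_addC : commutative dual_add.
Proof. by move=> f g; apply/dualT_eq/funext => x /=; rewrite addrC. Qed.
Lemma dual_add0 : left_id dual0 dual_add.
Proof. by move=> f; apply/dualT_eq/funext => x /=; rewrite add0r. Qed.
Lemma dual_addN : left_inverse dual0 dual_opp dual_add.
Proof. by move=> f; apply/dualT_eq/funext => x /=; rewrite addNr. Qed.

HB.instance Definition _ := gen_eqMixin D.
HB.instance Definition _ := gen_choiceMixin D.
HB.instance Definition _ :=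
  GRing.isZmodule.Build D dual_addA dual_addC dual_add0 dual_addN.

Lemma dual_addE f g x : (f + g : D) x = f x + g x. Proof. by []. Qed.
Lemma dual_oppE f x : (- f : D) x = - f x. Proof. by []. Qed.

Definition dual_le f g := forall x, lle (bl_lgroup E) 0 x -> f x <= g x.

Definition dual_join f g : D :=
  g + DualT (blin_pos_bounded_lin (dfunP (f - g))).

Lemma dual_le_refl f : dual_le f f. Proof. by move=> x _. Qed.
Lemma dual_le_trans f g h : dual_le f g -> dual_le g h -> dual_le f h.
Proof. by move=> fg gh x x0; apply: le_trans (fg x x0) (gh x x0). Qed.
Lemma dual_le_anti f g : dual_le f g -> dual_le g f -> f = g.
Proof.
move=> fg gf; apply/dualT_eq/blin_ext; try exact: dfunP.
by move=> x x0; apply/eqP; rewrite eq_le fg // gf.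
Qed.
Lemma dual_le_add f g h : dual_le f g -> dual_le (f + h) (g + h).
Proof. by move=> fg x x0; rewrite !dual_addE lerD2r fg. Qed.
Lemma dual_join_ubl f g : dual_le f (dual_join f g).
Proof.
move=> x x0; rewrite dual_addE -lerBlDl.
exact: (blin_pos_ub (dfunP (f - g)) x0).
Qed.
Lemma dual_join_ubr f g : dual_le g (dual_join f g).
Proof.
move=> x x0; rewrite dual_addE lerDl.
exact: (blin_pos_ge0 (dfunP (f - g))).
Qed.
Lemma dual_join_least f g h : dual_le f h -> dual_le g h -> dual_le (dual_join f g) h.
Proof.
move=> fh gh x x0; rewrite dual_addE -lerBrDl.
apply: (blin_pos_least (dfunP (f - g)) (dfunP (h - g))) => // y y0.
  by rewrite dual_addE dual_oppE subr_ge0 gh.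
by rewrite !dual_addE !dual_oppE lerD2r fh.
Qed.

Definition dual_lgroup : lgroup D :=
  LGroup dual_le_refl dual_le_trans dual_le_anti dual_le_add
    dual_join_ubl dual_join_ubr dual_join_least.

End DualGroup.

(** * Weak* cluster points *)

Lemma cvg0P (R : realType) (u : nat -> R) : u @ \oo --> (0 : R) <->
  forall e, 0 < e -> exists N, forall n, (N <= n)%N -> `|u n| < e.
Proof.
split=> [/cvgr0Pnorm_lt h e /h [N _ hN]|h]; first by exists N => n; apply: hN.
by apply/cvgr0Pnorm_lt => e /h [N hN]; exists N => // n; apply: hN.
Qed.

Lemma not_cvg0 (R : realType) (u : nat -> R) : ~ (u @ \oo --> (0 : R)) ->
  exists2 e, 0 < e & forall N, exists2 n, (N <= n)%N & e <= `|u n|.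
Proof.
move=> h; apply: contrapT => h'; apply: h; apply/cvg0P => e e0.
apply: contrapT => h; apply: h'; exists e => // N; apply: contrapT => h'.
apply: h; exists N => n Nn; rewrite ltNge; apply/negP => en.
by apply: h'; exists n.
Qed.

Lemma ultra_fmap T U (f : T -> U) (F : set_system T) :
  UltraFilter F -> UltraFilter (f @ F).
Proof.
move=> FU; split; first exact: fmap_proper_filter.
move=> H HP sub; rewrite eqEsubset; split => // A HA.
have [//|nA] := in_ultra_setVsetC (f @^-1` A) FU.
have /(filterI HA) : H (~` A) by apply: sub.
by rewrite setICr => /filter_not_empty.
Qed.

Section WeakStarCluster.
Variables (R : realType) (F : BanachLattice R).
Local Notation blin := (@bounded_lin R (vl_of F)).

(** A form of the Banach-Alaoglu theorem: an ultrafilter finer than the eventual filter has a limit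
    at each point, by compactness of segments, and these limits form [g]. Weak* neighbourhoods are
    spelled out by finitely many points and a tolerance. *)
Lemma weakstar_cluster (f : nat -> blT F -> R) (M : R) :
  (forall n, blin (f n)) -> (forall n x, `|f n x| <= M * `|x|) ->
  exists2 g, blin g & forall (ys : seq (blT F)) (e : R) N, 0 < e ->
    exists2 n, (N <= n)%N & forall y, y \in ys -> `|f n y - g y| < e.
Proof.
move=> fP fM.
have [U [UU subU]] := ultraFilterLemma eventually_filter.
have UF : ProperFilter U by exact: ultra_proper.
have lim_ex y : exists l : R, (fun n => f n y) @ U --> l.
  have := @segment_compact R (- (M * `|y|)) (M * `|y|).
  rewrite compact_ultra => /(_ _ (ultra_fmap (fun n => f n y) UU))[|l [_ ?]].
    by apply: (@filterE _ U) => n; rewrite /= in_itv /= -ler_norml; apply: fM.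
  by exists l.
have [g gl] := choice lim_ex.
have gE (ys : seq (blT F)) (e : R) N : 0 < e ->
    exists2 n, (N <= n)%N & forall y, y \in ys -> `|f n y - g y| < e.
  move=> e0.
  suff : U [set n | (N <= n)%N /\ forall y, y \in ys -> `|f n y - g y| < e].
    by move=> /filter_ex[n [Nn hn]]; exists n.
  apply: filterI; first by apply: subU; exists N.
  elim: ys => [|y ys IH]; first by apply: filterE => n.
  have /cvgrPdist_lt/(_ e e0) := gl y; apply: filterS2 IH => n hn hy z.
  by rewrite inE => /predU1P[->|/hn//]; rewrite distrC.
exists g => //; split=> [a x y _ _ /=|]; last first.
  exists M => y _ /=; apply/ler_addgt0Pr => e e0.
  have [n _ /(_ y (mem_head _ _))] := gE [:: y] e 0%N e0.
  rewrite ltr_norml => /andP[h1 h2]; have := fM n y.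
  rewrite !ler_norml => /andP[h3 h4]; apply/andP; split; lra.
apply/eqP; rewrite -subr_eq0 -normr_le0; apply/ler_addgt0Pr => e e0; rewrite add0r.
(* The linearity defect of [g] at [a], [x], [y] is bounded by [e' + |a| * e' + e' = e]. *)
pose e' := e / (`|a| + 2).
have a2 : 0 < `|a| + 2 by apply: ltr_wpDl.
have e'0 : 0 < e' by rewrite divr_gt0.
have [n _ h] := gE [:: a *: x + y; x; y] e' 0%N e'0.
have h1 := h (a *: x + y) (mem_head _ _).
have h2 : `|f n x - g x| < e' by apply: h; rewrite !inE eqxx orbT.
have h3 : `|f n y - g y| < e' by apply: h; rewrite !inE eqxx !orbT.
have -> : e = e' + (`|a| * e' + e') by rewrite /e'; field; rewrite gt_eqF.
have -> : g (a *: x + y) - (a * g x + g y) =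
    - (f n (a *: x + y) - g (a *: x + y)) + (a * (f n x - g x) + (f n y - g y)).
  by rewrite (blin_linear (fP n)); ring.
apply: le_trans (ler_normD _ _) _; rewrite normrN; apply: lerD; first exact: ltW.
apply: le_trans (ler_normD _ _) _; rewrite normrM; apply: lerD; last exact: ltW.
by rewrite ler_wpM2l // ltW.
Qed.

End WeakStarCluster.

(** * Order continuous duals *)

Section OrderContinuousDual.
Variables (R : realType) (F : BanachLattice R).
Implicit Types (x y z u : blT F).

Local Notation L := (bl_lgroup F).
Local Notation "x =<= y" := (lle L x y) (at level 70).
Local Notation meet := (lmeet L).
Local Notation pos := (lpos L).
Local Notation abs := (labs L).
Local Notation blin := (@bounded_lin R (vl_of F)).

(** The cone is closed: [pos (x - l)] lies below [pos (u n - l)], whose norm is at most that of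
    [u n - l]. *)
Lemma lle_lim (u : nat -> blT F) x l N : (forall n, (N <= n)%N -> x =<= u n) ->
  u @ \oo --> l -> x =<= l.
Proof.
move=> xu ul; suff p0 : pos (x - l) = 0.
  apply/lle_sub0; rewrite -(opprB x) (lposB L (x - l)) p0 sub0r opprK.
  exact: lpos_ge0.
apply/eqP; rewrite -normr_le0; apply/ler_addgt0Pr => e e0; rewrite add0r.
have /cvgrPdist_lt/(_ e e0)[N' _ hN'] := ul.
have /ltW := hN' (maxn N N') (leq_maxr _ _); apply: le_trans.
rewrite distrC; apply: le_trans (norm_pos _).
apply: norm_mono; first exact: lpos_ge0.
apply: lpos_mono; apply: lle_addr; apply: xu; exact: leq_maxl.
Qed.

Section PositiveFunctional.
Variables (psi : blT F -> R) (psiP : blin psi).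
Hypothesis psi_ge0 : forall x, 0 =<= x -> 0 <= psi x.
Hypothesis hF : order_continuous (dual (vl_of F)).

Let psi_cone : cone_functional L psi.
Proof. by split => // x y _ _; apply: (blinD psiP). Qed.

(** The components [t n] of [psi] in the bands of the tails decrease to 0 in the dual, hence in
    norm. Since [psi (y n) <= t n (y n)], boundedness of the [y n] concludes. *)
Lemma disjoint_vanish (y : nat -> blT F) (M e : R) :
  (forall n, 0 =<= y n) -> (forall n, `|y n| <= M) ->
  (forall m n, (m < n)%N -> meet (y m) (y n) = 0) -> 0 < e ->
  exists n, psi (y n) < e.
Proof.
move=> y0 yM ydisj e0; pose t n := cone_ext (tail L psi y n).
have tC n : cone_functional L (tail L psi y n) by apply: tail_cone.
have tE n x : 0 =<= x -> t n x = tail L psi y n x by apply: cone_extE.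
have [C C0 psiC] := blin_bound psiP.
have tP n : blin (t n).
  apply: (@cone_ext_bounded_lin _ _ _ C) => // x x0.
  apply: le_trans (le_trans (ler_norm _) (psiC x)).
  by apply: (band_le psi_cone) => // j; apply: tail_sum_ge0.
have M0 : 0 <= M by apply: le_trans (yM 0%N).
have M1 : 0 < M + 1 by apply: ltr_wpDl.
have e1 : 0 < e / (M + 1) by rewrite divr_gt0.
have leq_tr (i j k : nat) : (i <= j)%N -> (j <= k)%N -> (i <= k)%N by apply: leq_trans.
have leq_dir (i j : nat) : exists k, (i <= k)%N /\ (j <= k)%N.
  by exists (maxn i j); rewrite leq_maxl leq_maxr.
have t_anti i j : (i <= j)%N -> vle (dual (vl_of F)) (t j) (t i).
  by move=> ij x _ x0; rewrite !tE //; apply: tail_anti.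
have t_inf : @is_inf R (dual (vl_of F)) (range t) (fun=> 0).
  split; first exact: blin_zero.
  split=> [_ [n _ <-] x _ x0|b bP bt x _ x0] /=.
    by rewrite tE //; apply: (tC n).2.
  apply/ler_addgt0Pr => d d0; rewrite add0r.
  have [n tn] := tail_vanish psi_cone y0 ydisj x0 d0.
  have btn : vle (dual (vl_of F)) b (t n) by apply: bt; exists n.
  by apply: ltW; apply: le_lt_trans tn; rewrite -tE //; apply: btn.
(* Dividing by [M + 1] covers the case [M = 0]. *)
have [n /(_ _ (leqnn _)) tn] :=
  @hF nat (fun m n => (m <= n)%N) t (inhabits 0%N) leqnn leq_tr leq_dir tP t_anti
    t_inf (e / (M + 1)) e1.
exists n.
apply: le_lt_trans (tail_head psi_cone y0 n) _; rewrite -tE //.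
apply: le_lt_trans (ler_norm _) _; apply: le_lt_trans (dual_norm_ge (tP n) _) _.
apply: (@le_lt_trans _ _ (e / (M + 1) * M)).
  apply: (@le_trans _ _ (e / (M + 1) * `|y n|)).
    by rewrite ler_wpM2r // ltW.
  by rewrite ler_wpM2l // ltW.
rewrite -mulrA gtr_pMr // mulrC ltr_pdivrMr // mul1r; lra.
Qed.

(** If the values stay above [e] along a subsequence, terms [z k] almost disjoint from the earlier
    ones are selected and cut down to a truly disjoint sequence [y k], against [disjoint_vanish]. *)
Lemma positive_vanish (v : nat -> blT F) (M : R) :
  (forall n, 0 =<= v n) -> (forall n, `|v n| <= M) ->
  (forall u, 0 =<= u -> (fun n => psi (meet (v n) u)) @ \oo --> (0 : R)) ->
  (fun n => psi (v n)) @ \oo --> (0 : R).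
Proof.
move=> v0 vM vu; apply: contrapT => /not_cvg0[e e0 hv].
have e4 : 0 < e / 4 by rewrite divr_gt0.
(* The pair holds the stage [k] and the sum of the terms chosen so far; under [psi], the next term
   is almost disjoint from [4 ^ k] times that sum. *)
have pick_ex (q : nat * blT F) : exists n, 0 =<= q.2 ->
    e <= psi (v n) /\ psi (meet (4 ^+ q.1 *: q.2) (v n)) < e / 4.
  case: q => k S /=; have [S0|//] := pselect (0 =<= S); last by exists 0%N.
  have /cvg0P/(_ _ e4)[N hN] := vu _ (lscale_ge0 (exprn_ge0 k (ler0n R 4)) S0).
  have [n Nn en] := hv N; exists n => _; split.
    by rewrite ger0_norm // psi_ge0 in en.
  by rewrite lmeetC; apply: le_lt_trans (ler_norm _) (hN n Nn).
have [pick pickP] := choice pick_ex.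
pose S := fix S k := if k is j.+1 then S j + v (pick (j, S j)) else 0.
pose z k := v (pick (k, S k)).
have z0 k : 0 =<= z k by apply: v0.
have zM k : `|z k| <= M by apply: vM.
have S0 k : 0 =<= S k.
  elim: k => [|k IH] /=; [exact: lle_refl | exact: ladd_ge0].
have Sz m k : (m < k)%N -> z m =<= S k.
  elim: k => // k IH; rewrite ltnS leq_eqVlt => /orP[/eqP->|/IH h] /=.
    by rewrite addrC; apply: lle_addr0.
  by apply: lle_trans h _; apply: lle_addr0.
have zP k := pickP (k, S k) (S0 k).
pose h k : R := 2^-1 ^+ k.
have h0 k : 0 <= h k by rewrite exprn_ge0 ?invr_ge0.
(* The weights make the series absolutely convergent, so completeness gives a [w] that dominates
   every [h k *: z k]. *)
have hs : cvgn (series (fun k => h k *: z k)).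
  have M0 : 0 <= M by apply: le_trans (zM 0%N).
  apply: normed_cvg; apply: (@series_le_cvg _ _ (geometric M 2^-1)) => [n|n|n|].
  - exact: normr_ge0.
  - by rewrite mulr_ge0 ?h0.
  - by rewrite /= normrZ ger0_norm // mulrC ler_wpM2r.
  - by apply: is_cvg_geometric_series; rewrite ger0_norm ?invf_lt1 ?invr_ge0 ?ltr1n.
set w := limn (series (fun k => h k *: z k)) in hs *.
have hz0 k : 0 =<= h k *: z k by apply: lscale_ge0.
have zw k : h k *: z k =<= w.
  apply: (@lle_lim _ _ _ k.+1) hs => n kn; rewrite /series /=.
  rewrite (big_cat_nat (n := k.+1)) //= big_nat_recr //= addrAC addrC.
  by apply: lle_addr0; apply: ladd_ge0; apply: lsum_ge0.
have w0 : 0 =<= w by apply: lle_trans (zw 0%N).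
(* The first summand makes [y k] disjoint from the earlier [y m], the second
   one from the later ones. *)
pose q k := 4 ^+ k *: S k + h k *: w.
have q0 k : 0 =<= q k.
  by apply: ladd_ge0; apply: lscale_ge0 => //; rewrite exprn_ge0.
pose y k := pos (z k - q k).
have y0 k : 0 =<= y k by apply: lpos_ge0.
have yz k : y k =<= z k.
  by apply: ljoin_least => //; apply/lle_subl; apply: lle_addr0.
have ydisj m k : (m < k)%N -> meet (y m) (y k) = 0.
  (* [y m] lies below the positive part of [t], and [y k] below a multiple of its negative part. *)
  move=> mk; pose t := z m - h (m + k)%N *: z k.
  have ym : y m =<= pos t.
    apply: lpos_mono; apply: lle_addl; apply: lle_opp.
    apply: (@lle_trans _ _ _ (h m *: w)).
      by rewrite /h exprD -scalerA; apply: lle_scale => //; apply: zw.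
    by rewrite /q addrC; apply: lle_addr0; apply: lscale_ge0; rewrite ?exprn_ge0.
  have yk : y k =<= pos (- t) *+ 2 ^ (m + k).
    apply: ljoin_least; last by apply/lmulrn_ge0/lpos_ge0.
    apply: lle_trans (lle_mulrn2r _ (lle_pos L (- t))).
    rewrite opprB -scaler_nat scalerBr scalerA natrX -exprMn divff ?pnatr_eq0 //.
    rewrite expr1n scale1r; apply: lle_addl; apply: lle_opp.
    (* From [m < k], the factor [2 ^ (m + k)] is at most [4 ^ k]; hence the 4 in [q]. *)
    apply: (@lle_trans _ _ _ (4 ^+ k *: z m)).
      apply: lle_scalel => //; have -> : 4 = 2 ^+ 2 :> R by rewrite -natrX.
      by rewrite -exprM ler_weXn2l ?ler1n // mul2n -addnn leq_add2r ltnW.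
    apply: (@lle_trans _ _ _ (4 ^+ k *: S k)).
      by apply: lle_scale; [rewrite exprn_ge0 | apply: Sz].
    by apply: lle_addr0; apply: lscale_ge0.
  apply: lle_anti; last exact: lmeet_ge0.
  apply: lle_trans (lmeet_mono ym yk) _.
  rewrite lmeetC disjoint_mulrn; first exact: lle_refl.
  - exact: lpos_ge0.
  - exact: lpos_ge0.
  - by rewrite lmeetC lmeet_posN.
(* Subtracting [q k] costs at most [e / 4] for the earlier terms and [h k * psi w] for the
   series. *)
have psiy k : 3 * (e / 4) - h k * psi w <= psi (y k).
  have [z1 z2] := zP k.
  rewrite /y -lsub_meet (blinB psiP).
  have : psi (meet (z k) (q k)) <= e / 4 + h k * psi w.
    rewrite lmeetC -(blinZ psiP).
    apply: le_trans (lerD (ltW z2) (lexx _)).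
    rewrite -(blinD psiP); apply: (cone_mono psi_cone); first exact: lmeet_ge0.
    have a0 : 0 =<= 4 ^+ k *: S k by apply: lscale_ge0; rewrite ?exprn_ge0.
    apply: lle_trans (lmeet_addl a0 (lscale_ge0 (h0 k) w0) (z0 k)) _.
    by apply: lle_addl; apply: lmeet_lbl.
  move: z1; rewrite -/(z k); lra.
have /cvg0P/(_ _ e4)[K hK] : (fun k => h k * psi w) @ \oo --> (0 : R).
  have hc : h @ \oo --> (0 : R).
    by apply: cvg_expr; rewrite ger0_norm ?invf_lt1 ?invr_ge0 ?ltr1n.
  have /= := cvgM hc (cvg_cst (psi w)); rewrite mul0r; exact.
have e2 : 0 < e / 2 by rewrite divr_gt0.
(* From [K] on the loss [h k * psi w] is below [e / 4], which leaves more than [e / 2]. *)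
have [||| n] := @disjoint_vanish (fun k => y (K + k)%N) M (e / 2) _ _ _ e2.
- by move=> n; apply: y0.
- by move=> n; apply: le_trans (zM (K + n)%N); apply: norm_mono.
- by move=> m n mn; apply: ydisj; rewrite ltn_add2l.
have := hK _ (leq_addr n K); rewrite ltr_norml => /andP[_].
have := psiy (K + n)%N; lra.
Qed.

End PositiveFunctional.

Lemma uaw_null_weak_null (hF : order_continuous (dual (vl_of F)))
    (z : nat -> blT F) (M : R) (phi : blT F -> R) : blin phi ->
  (forall n, `|z n| <= M) ->
  (forall u psi, 0 =<= u -> blin psi ->
     (fun n => psi (meet (abs (z n)) u)) @ \oo --> (0 : R)) ->
  (fun n => phi (z n)) @ \oo --> (0 : R).
Proof.
move=> phiP zM zu.
have phiN := blin_opp phiP.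
(* [psi] is the modulus of [phi], the sum of its positive and negative parts. *)
pose psi x := blin_pos phi x + blin_pos (fun x => - phi x) x.
have psiP : blin psi.
  by apply: blin_add; apply: blin_pos_bounded_lin.
have psi_ge0 x : 0 =<= x -> 0 <= psi x.
  by move=> x0; rewrite addr_ge0 //; apply: blin_pos_ge0.
have phi_psi x : 0 =<= x -> `|phi x| <= psi x.
  move=> x0; have := blin_pos_ub phiP x0; have := blin_pos_ub phiN x0.
  have := blin_pos_ge0 phiP x0; have := blin_pos_ge0 phiN x0.
  rewrite /psi ler_norml => *; apply/andP; split; lra.
have phi_abs x : `|phi x| <= psi (abs x).
  rewrite labsE (blinD psiP) {1}(lposB L x) (blinB phiP).
  apply: le_trans (ler_normB _ _) _.
  by rewrite lerD //; apply: phi_psi; apply: lpos_ge0.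
have /cvg0P h : (fun n => psi (abs (z n))) @ \oo --> (0 : R).
  apply: (@positive_vanish _ psiP psi_ge0 hF _ M) => [n|n|u u0].
  - exact: labs_ge0.
  - by rewrite norm_labs.
  - exact: zu.
apply/cvg0P => e /h[N hN]; exists N => n /hN.
by apply: le_lt_trans; apply: le_trans (phi_abs _) (ler_norm _).
Qed.

End OrderContinuousDual.

(** * Absolute values and meets of the statement as lattice operations *)

Section Specification.
Variables (R : realType) (E : BanachLattice R).
Implicit Types x a u m : blT E.

Local Notation L := (bl_lgroup E).
Local Notation DL := (dual_lgroup E).

Lemma is_abs_labs x a : @is_abs R (vl_of E) x a -> a = labs L x.
Proof.
move=> [_ [xa [nxa aleast]]]; apply: (@lle_anti _ L).
  by apply: aleast => //; [apply: (ljoin_ubl L) | apply: (ljoin_ubr L)].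
exact: (@ljoin_least _ L).
Qed.

Lemma is_meet_lmeet x u m : @is_meet R (vl_of E) x u m -> m = lmeet L x u.
Proof.
move=> [_ [mx [mu mgreatest]]]; apply: (@lle_anti _ L).
  exact: (@lmeet_greatest _ L).
by apply: mgreatest => //; [apply: (lmeet_lbl L) | apply: (lmeet_lbr L)].
Qed.

Lemma dual_labs_is_abs (f : dualT E) :
  @is_abs R (dual (vl_of E)) f (labs DL f).
Proof.
split; first exact: dfunP.
split; first by move=> x _ x0; apply: (ljoin_ubl DL f (- f) x x0).
split; first by move=> x _ x0; apply: (ljoin_ubr DL f (- f) x x0).
move=> b bP fb nfb.
have : lle DL (labs DL f) (DualT bP).
  by apply: ljoin_least => x x0; [apply: fb | apply: nfb].
by move=> h x _; apply: h.
Qed.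

Lemma dual_lmeet_is_meet (f g : dualT E) :
  @is_meet R (dual (vl_of E)) f g (lmeet DL f g).
Proof.
split; first exact: dfunP.
split; first by move=> x _ x0; apply: (lmeet_lbl DL f g x x0).
split; first by move=> x _ x0; apply: (lmeet_lbr DL f g x x0).
move=> b bP bf bg.
have : lle DL (DualT bP) (lmeet DL f g).
  by apply: lmeet_greatest => x x0; [apply: bf | apply: bg].
by move=> h x _; apply: h.
Qed.

Lemma dual_norm_le_bound (c b : dualT E) (K : R) : 0 <= K ->
  lle DL 0 c -> lle DL c b -> (forall x, b x <= K * `|x|) ->
  @vnorm R (dual (vl_of E)) c <= K.
Proof.
move=> K0 c0 cb bK; apply: dual_norm_le => // x.
have cP := dfunP c.
have p1 := c0 _ (lpos_ge0 L x); have p2 := c0 _ (lpos_ge0 L (- x)).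
have : c (labs L x) <= K * `|x|.
  rewrite -(norm_labs x); apply: le_trans (bK _); apply: cb; exact: labs_ge0.
have -> : c x = c (lpos L x) - c (lpos L (- x)) by rewrite -(blinB cP) -lposB.
rewrite labsE (blinD cP) ler_norml.
by move=> h; apply/andP; split; move: p1 p2 h; rewrite /=; lra.
Qed.

End Specification.

(** * Moduli of functionals on the dual *)

Section Bidual.
Variables (R : realType) (E : BanachLattice R).
Variables (phi : (blT E -> R) -> R).
Hypothesis phiP : @bounded_lin R (dual (vl_of E)) phi.
Local Notation DL := (dual_lgroup E).

Lemma bidualD (f g : dualT E) : phi (f + g : dualT E) = phi f + phi g.
Proof.
rewrite -[phi f]mul1r -(phiP.1 1 _ _ (dfunP f) (dfunP g)); congr phi.
by apply/funext => x /=; rewrite mul1r.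
Qed.

(** [Phi] is the modulus of [phi] on the cone of the dual, the sum of the Riesz-Kantorovich positive
    parts of [phi] and [- phi]. Its norm bound is phrased through pointwise estimates of [b], as
    they are available for multiples of the order unit. *)
Lemma bidual_majorant : exists2 Phi : dualT E -> R, cone_functional DL Phi &
  (forall c, lle DL 0 c -> `|phi c| <= Phi c) /\
  exists2 C : R, 0 <= C & forall (b : dualT E) K, 0 <= K -> lle DL 0 b ->
    (forall x, b x <= K * `|x|) -> Phi b <= C * K.
Proof.
have [C0 hC0] := phiP.2.
pose C := `|C0|.
have hC (c b : dualT E) K : 0 <= K -> lle DL 0 c -> lle DL c b ->
    (forall x, b x <= K * `|x|) -> `|phi c| <= C * K.
  move=> K0 c0 cb bK; apply: le_trans (hC0 c (dfunP c)) _.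
  apply: (@le_trans _ _ (C * @vnorm R (dual (vl_of E)) c)).
    by rewrite ler_wpM2r ?ler_norm //; apply: dual_norm_ge0 (dfunP c).
  by rewrite ler_wpM2l ?normr_ge0 // (dual_norm_le_bound K0 c0 cb).
have phiND (f g : dualT E) : - phi (f + g : dualT E) = - phi f + - phi g.
  by rewrite bidualD opprD.
have bnd (b : dualT E) : exists2 K, 0 <= K & forall x, b x <= K * `|x|.
  have [K K0 hK] := blin_bound (dfunP b); exists K => // x.
  exact: le_trans (ler_norm _) (hK x).
have ub b : lle DL 0 b ->
    exists M, forall c : dualT E, lle DL 0 c -> lle DL c b -> phi c <= M.
  move=> _; have [K K0 hK] := bnd b; exists (C * K) => c c0 cb.
  by apply: le_trans (ler_norm _) _; apply: hC c0 cb hK.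
have ubN b : lle DL 0 b ->
    exists M, forall c : dualT E, lle DL 0 c -> lle DL c b -> - phi c <= M.
  move=> _; have [K K0 hK] := bnd b; exists (C * K) => c c0 cb.
  by apply: le_trans (ler_norm _) _; rewrite normrN; apply: hC c0 cb hK.
pose P := rk DL (fun c : dualT E => phi c).
pose N := rk DL (fun c : dualT E => - phi c).
have PP : cone_functional DL P by apply: rk_cone => //; apply: bidualD.
have NP : cone_functional DL N by apply: rk_cone.
exists (fun c => P c + N c).
  split=> [f g f0 g0|f f0]; last by rewrite addr_ge0 ?PP.2 ?NP.2.
  by rewrite PP.1 // NP.1 // addrACA.
split=> [c c0|].
  have h1 : phi c <= P c by apply: rk_ub => //; apply: lle_refl.
  have h2 : - phi c <= N c.
    by apply: (rk_ub ubN) => //; apply: lle_refl.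
  have := PP.2 _ c0; have := NP.2 _ c0; rewrite ler_norml => *.
  by apply/andP; split; lra.
exists (2 * C); first by rewrite mulr_ge0 // /C normr_ge0.
move=> b K K0 b0 bK; rewrite -mulrA [2 * _]mulrDl mul1r; apply: lerD;
  apply: rk_least => // c c0 cb; apply: le_trans (ler_norm _) _;
  rewrite ?normrN; exact: hC c0 cb bK.
Qed.

End Bidual.

Lemma leq_increasing (s : nat -> nat) : (forall k, (s k < s k.+1)%N) ->
  forall k, (k <= s k)%N.
Proof. by move=> sS; elim=> // k IH; apply: leq_ltn_trans IH (sS k). Qed.

(** * The adjoint operator *)

Section Operator.
Variables (R : realType) (E F : BanachLattice R).
Variables (T : blT E -> blT F).
Hypothesis hT : @bounded_op R (vl_of E) (vl_of F) T.

Local Notation LE := (bl_lgroup E).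
Local Notation DL := (dual_lgroup E).
Local Notation blinE := (@bounded_lin R (vl_of E)).
Local Notation blinF := (@bounded_lin R (vl_of F)).

Lemma op_bound : exists2 C : R, 0 <= C & forall x, `|T x| <= C * `|x|.
Proof.
have [_ [_ [C hC]]] := hT; exists `|C| => // x.
by apply: le_trans (hC x I) _; rewrite ler_wpM2r //= ler_norm.
Qed.

Lemma blin_comp (f : blT F -> R) : blinF f -> blinE (fun x => f (T x)).
Proof.
move=> fP; have [_ [Tlin _]] := hT; split=> [a x y _ _|].
  by rewrite [T _](Tlin a x y I I); apply: fP.1.
have [C C0 hC] := op_bound; have [D D0 hD] := blin_bound fP.
exists (D * C) => x _; apply: le_trans (hD _) _.
by rewrite -mulrA ler_wpM2l.
Qed.

(** The differences [T (x (s n)) - y] are bounded, so [uaw_null_weak_null] turns their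
    uaw-convergence into weak convergence. *)
Lemma uaw_compact_weakly_compact (hF : order_continuous (dual (vl_of F)))
    (hc : @seq_uaw_compact R (vl_of E) (vl_of F) T)
    (x : nat -> blT E) (M : R) : (forall n, `|x n| <= M) ->
  exists (s : nat -> nat) (y : blT F), (forall n, (s n < s n.+1)%N) /\
    forall f, blinF f -> (fun n => f (T (x (s n)))) @ \oo --> f y.
Proof.
move=> xM; have [s [y [sS [_ Ty]]]] := hc x (fun=> I) (ex_intro _ M xM).
exists s, y; split=> // f fP; apply/subr_cvg0.
have [C C0 hC] := op_bound.
have zM n : `|T (x (s n)) - y| <= C * M + `|y|.
  apply: le_trans (ler_normB _ _) _; rewrite lerD2r.
  by apply: le_trans (hC _) _; rewrite ler_wpM2l.
have := uaw_null_weak_null hF fP zM; rewrite (_ : (fun n => f _) =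
  (fun n => f (T (x (s n))) - f y)); last by apply/funext => n; rewrite (blinB fP).
apply=> u psi u0 psiP; have [h [hh h0]] := Ty u I u0.
rewrite (_ : (fun n => psi _) = (fun n => psi (h n))); first exact: h0.
apply/funext => n; have [a [/is_abs_labs-> /is_meet_lmeet->]] := hh n.
by [].
Qed.

(** * The order unit of the dual of an AL-space *)

Section Adjoint.
Hypothesis hE : AL_space E.
Hypothesis weakly_compact : forall (x : nat -> blT E) (M : R),
  (forall n, `|x n| <= M) ->
  exists (s : nat -> nat) (y : blT F), (forall n, (s n < s n.+1)%N) /\
    forall f, blinF f -> (fun n => f (T (x (s n)))) @ \oo --> f y.

(* On an AL-space the norm extends from the cone to a functional, the order
   unit of the dual. *)
Definition norm_functional : blT E -> R := cone_ext (fun x : blT E => `|x| : R).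

Let norm_cone : cone_functional LE (fun x => `|x| : R).
Proof. by split=> // x y; apply: hE. Qed.

Lemma norm_functionalE x : lle LE 0 x -> norm_functional x = `|x|.
Proof. exact: cone_extE. Qed.

Lemma norm_functional_blin : blinE norm_functional.
Proof. by apply: (@cone_ext_bounded_lin _ _ _ 1) => // x _; rewrite mul1r. Qed.

Lemma scaled_norm_blin (k : R) : blinE (fun x => k * norm_functional x).
Proof.
have eP := norm_functional_blin; split=> [a x y _ _|].
  by rewrite /= (blin_linear eP) mulrDr mulrCA.
have [C C0 hC] := blin_bound eP; exists (`|k| * C) => x _.
by rewrite normrM -mulrA ler_wpM2l.
Qed.

Definition unit_mul k : dualT E := DualT (scaled_norm_blin k).

Lemma unit_mulE k x : lle LE 0 x -> unit_mul k x = k * `|x|.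
Proof. by move=> x0 /=; rewrite norm_functionalE. Qed.

Lemma unit_mul_ge0 k : 0 <= k -> lle DL 0 (unit_mul k).
Proof. by move=> k0 x x0; rewrite unit_mulE // mulr_ge0. Qed.

Lemma unit_mul_le k x : 0 <= k -> unit_mul k x <= k * `|x|.
Proof.
move=> k0; rewrite /= ler_wpM2l //.
by apply: le_trans (norm_pos x); rewrite lerBlDr lerDl.
Qed.

(** Norm-bounded sets of functionals are thus order bounded; this provides the bound [b] of
    [infima_subsequence]. *)
Lemma le_unit_mul (f : dualT E) k : (forall x, `|f x| <= k * `|x|) ->
  lle DL f (unit_mul k).
Proof.
by move=> fk x x0; rewrite unit_mulE //; apply: le_trans (ler_norm _) (fk x).
Qed.

(** * Separating points and the diagonal subsequence *)

Section Sequence.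
Variables (f : nat -> blT F -> R) (M : R).
Hypothesis fP : forall n, blinF (f n).
Hypothesis fM : forall n x, `|f n x| <= M * `|x|.
Variables (f0 : blT F -> R).
Hypothesis f0P : blinF f0.
Hypothesis f0_cluster : forall (ys : seq (blT F)) (e : R) N, 0 < e ->
  exists2 n, (N <= n)%N & forall y, y \in ys -> `|f n y - f0 y| < e.

Definition adjoint_diff n : dualT E :=
  DualT (blin_comp (fP n)) - DualT (blin_comp f0P).

Local Notation H := adjoint_diff.

Definition signed (b : bool) (h : dualT E) : dualT E := if b then - h else h.

Lemma signedE b h x : signed b h x = (-1) ^+ b * h x.
Proof. by case: b; rewrite /= ?expr1 ?mulN1r ?expr0 ?mul1r. Qed.

(** A finite list of indices with signs and a threshold coded by a natural number form a countable
    type, so one point chosen for each [q] gives the countable family. *)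
Definition separates (q : seq (nat * bool) * nat) (x : blT E) :=
  [/\ lle LE 0 x, `|x| <= 1 &
     forall nb, nb \in q.1 -> q.2.+1%:R^-1 < signed nb.2 (H nb.1) x].

Lemma H_bound : exists2 K : R, 0 <= K & forall n x, `|H n x| <= K * `|x|.
Proof.
have [C C0 hC] := op_bound; have [D D0 hD] := blin_bound f0P.
exists ((`|M| + D) * C) => [|n x]; first by rewrite mulr_ge0 // addr_ge0.
rewrite /H dual_addE dual_oppE; apply: le_trans (ler_normB _ _) _.
apply: (@le_trans _ _ ((`|M| + D) * `|T x|)); last first.
  by rewrite -mulrA ler_wpM2l // addr_ge0.
rewrite mulrDl lerD //=; apply: le_trans (fM n (T x)) _.
by rewrite ler_wpM2r // ler_norm.
Qed.

Lemma separating_sequence (Phi : dualT E -> R) (C d0 : R) (s : nat -> nat) :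
  cone_functional DL Phi -> 0 <= C ->
  (forall (b : dualT E) K, 0 <= K -> lle DL 0 b ->
    (forall x, b x <= K * `|x|) -> Phi b <= C * K) -> 0 < d0 ->
  (forall N, exists2 n, (N <= n)%N & d0 <= Phi (labs DL (H (s n)))) ->
  exists (r : nat -> nat) (b : nat -> bool) (q : nat),
    (forall k, (r k < r k.+1)%N) /\
    forall k, exists x, separates ([seq (s (r i), b i) | i <- iota 0 k.+1], q) x.
Proof.
move=> PhiP C0 PhiC d00 hs.
(* Chosen so that [C * de <= d0 / 8], which bounds [Phi] at [de] times the order unit. *)
pose q := Num.bound (8 * C / d0); pose de : R := q.+1%:R^-1.
have de0 : 0 < de by rewrite invr_gt0.
have Phide : Phi (unit_mul de) <= d0 / 8.
  apply: le_trans (PhiC _ de (ltW de0) (unit_mul_ge0 (ltW de0)) _) _.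
    by move=> x; apply: unit_mul_le; apply: ltW.
  rewrite /de ler_pdivrMr // mulrC -ler_pdivrMr ?divr_gt0 //.
  have -> : C / (d0 / 8) = 8 * C / d0.
    by rewrite invf_div mulrA [C * 8]mulrC.
  apply: ltW; apply: lt_trans (archi_boundP _) _; last by rewrite ltr_nat.
  by rewrite divr_ge0 ?mulr_ge0 // ltW.
pose G b n := signed b (H (s n)) - unit_mul de.
(* The sign for which the positive part of [G] has the larger value under [Phi]. *)
pose bs n := Phi (lpos DL (G false n)) < Phi (lpos DL (G true n)).
have PhiG n : Phi (labs DL (H (s n))) <= d0 / 4 + 2 * Phi (lpos DL (G (bs n) n)).
  have u0 := unit_mul_ge0 (ltW de0).
  (* Each of the two parts of [H (s n)] is the positive part of a [signed] copy and loses at most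
     [d0 / 8] when passing to [G]; together this accounts for [d0 / 4]. *)
  have split b : lle DL (lpos DL (signed b (H (s n))))
      (lpos DL (G b n) + unit_mul de).
    apply: ljoin_least; last by apply: ladd_ge0 => //; apply: lpos_ge0.
    by apply/lle_subl; apply: lle_pos.
  have bnd b : Phi (lpos DL (signed b (H (s n)))) <=
      Phi (lpos DL (G b n)) + d0 / 8.
    apply: le_trans (cone_mono PhiP (lpos_ge0 _ _) (split b)) _.
    by rewrite PhiP.1 ?lerD2l //; apply: lpos_ge0.
  rewrite labsE PhiP.1; [|exact: lpos_ge0|exact: lpos_ge0].
  have /= := bnd false; have /= := bnd true.
  rewrite /bs; case: ltP => ?; lra.
have [K K0 hK] := H_bound.
have Gle n : lle DL (lpos DL (G (bs n) n)) (unit_mul K).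
  apply: ljoin_least; last exact: unit_mul_ge0.
  apply: (@lle_trans _ _ _ (signed (bs n) (H (s n)))).
    by apply/lle_subl; apply: lle_addr0; apply: unit_mul_ge0; apply: ltW.
  apply: le_unit_mul => x; rewrite signedE normrM normrX normrN normr1 expr1n.
  by rewrite mul1r hK.
have d4 : 0 < d0 / 4 by rewrite divr_gt0.
have [|r [rS rP]] := infima_subsequence PhiP d4 Gle.
  move=> N; have [n Nn hn] := hs N; exists n => //.
  by have := PhiG n; lra.
exists r, (fun i => bs (r i)), q; split=> // k.
have [d nd dG] := rP k.
have [x x0 dx] : exists2 x, lle LE 0 x & 0 < d x.
  apply: contrapT => h; apply: nd => x x0; rewrite leNgt; apply/negP => dx.
  by apply: h; exists x.
have nx : 0 < `|x|.
  rewrite normr_gt0; apply: contraTneq dx => ->.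
  by rewrite (blin0 (dfunP d)) ltxx.
(* On the cone the order unit is the norm, so [0 < d x] and [d =<= G] give a value above [de] times
   the norm of [x], and normalizing leaves [de]. *)
exists (`|x|^-1 *: x); split.
- by apply: lscale_ge0 => //; rewrite invr_ge0.
- by rewrite normrZ normfV normr_id mulVf ?gt_eqF.
move=> nb /mapP[i]; rewrite mem_iota add0n ltnS => /= ik ->.
rewrite (blinZ (dfunP _)) mulrC ltr_pdivlMr //.
have := lt_le_trans dx (dG i ik x x0).
by rewrite /G dual_addE dual_oppE unit_mulE // subr_gt0.
Qed.

Lemma adjoint_subsequence : exists s : nat -> nat,
  (forall k, (s k < s k.+1)%N) /\
  forall (Phi : dualT E -> R) (C : R), cone_functional DL Phi -> 0 <= C ->
  (forall (b : dualT E) K, 0 <= K -> lle DL 0 b ->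
    (forall x, b x <= K * `|x|) -> Phi b <= C * K) ->
  (fun n => Phi (labs DL (H (s n)))) @ \oo --> (0 : R).
Proof.
(* One point for each [q], with default 0 when no separating point exists. The family is fixed
   before [Phi], so that [s] does not depend on [Phi]. *)
have dex q : exists x, (exists x0, separates q x0) -> separates q x.
  by have [[x hx]|h] := pselect (exists x0, separates q x0); [exists x|exists 0].
have [d dP] := choice dex.
pose ys k := [seq T (d q) | q <- pmap unpickle (iota 0 k)].
have ysP q k : (pickle q < k)%N -> T (d q) \in ys k.
  move=> qk; apply: map_f; rewrite mem_pmap; apply/mapP; exists (pickle q).
    by rewrite mem_iota.
  by rewrite pickleK.
have pick_ex (kN : nat * nat) : exists n, (kN.2 <= n)%N /\
    forall y, y \in ys kN.1 -> `|f n y - f0 y| < kN.1.+1%:R^-1.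
  have [|n Nn hn] := @f0_cluster (ys kN.1) (kN.1.+1%:R^-1) kN.2.
    by rewrite invr_gt0.
  by exists n.
have [pick pickP] := choice pick_ex.
(* Diagonal choice: [f (s k)] is within [1 / (k + 1)] of [f0] on the images of the points with code
   below [k]. *)
pose s := fix s k := if k is j.+1 then pick (k, (s j).+1) else pick (0%N, 0%N).
have sS k : (s k < s k.+1)%N by have [] := pickP (k.+1, (s k).+1).
have sP k y : y \in ys k -> `|f (s k) y - f0 y| < k.+1%:R^-1.
  by case: k => [|k]; [have [_] := pickP (0%N, 0%N) |
    have [_] := pickP (k.+1, (s k).+1)]; apply.
have slim q : (fun n => f (s n) (T (d q))) @ \oo --> f0 (T (d q)).
  apply/subr_cvg0/cvg0P => e e0.
  exists (maxn (pickle q).+1 (Num.bound e^-1)) => n.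
  rewrite geq_max => /andP[qn en]; apply: lt_trans (sP n _ (ysP q n qn)) _.
  rewrite invf_plt ?posrE //; apply: lt_le_trans (archi_boundP _) _.
    by rewrite invr_ge0 ltW.
  by rewrite ler_nat ltnW.
exists s; split=> // Phi C PhiP C0 PhiC; apply: contrapT => /not_cvg0[d0 d00 hd].
have [|r [b [q [rS rP]]]] := separating_sequence (s := s) PhiP C0 PhiC d00.
  move=> N; have [n Nn hn] := hd N; exists n => //.
  by rewrite ger0_norm ?(PhiP.2 _ (labs_ge0 DL (H (s n)))) in hn.
pose Q k := ([seq (s (r i), b i) | i <- iota 0 k.+1], q).
have sepQ k : separates (Q k) (d (Q k)) by apply: dP; apply: rP.
have [|t [y [tS tP]]] := @weakly_compact (fun k => d (Q k)) 1.
  by move=> k; have [] := sepQ k.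
pose de : R := q.+1%:R^-1.
have de0 : 0 < de by rewrite invr_gt0.
(* For [k >= i] the point [d (Q (t k))] separates the index [s (r i)], and the bound passes to the
   weak limit [y]. *)
have far i : de <= `|f (s (r i)) y - f0 y|.
  have lim_i : (fun k => H (s (r i)) (d (Q (t k)))) @ \oo --> f (s (r i)) y - f0 y.
    exact: cvgB (tP _ (fP _)) (tP _ f0P).
  rewrite leNgt; apply/negP => hlt.
  have /cvgrPdist_lt/(_ (de - `|f (s (r i)) y - f0 y|))[|K _ hK] := lim_i.
    by rewrite subr_gt0.
  pose k := maxn K i.
  have := hK k (leq_maxl _ _).
  have ik : (i <= t k)%N by apply: leq_trans (leq_maxr K i) (leq_increasing tS k).
  have h1 : de < signed (b i) (H (s (r i))) (d (Q (t k))).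
    have [_ _ sep] := sepQ (t k); apply: (sep (s (r i), b i)).
    by apply: (map_f (fun i => (s (r i), b i))); rewrite mem_iota.
  rewrite signedE in h1 => h2.
  have h3 : de < `|H (s (r i)) (d (Q (t k)))|.
    apply: lt_le_trans h1 (le_trans (ler_norm _) _).
    by rewrite normrM normrX normrN normr1 expr1n mul1r.
  have := ler_distD (f (s (r i)) y - f0 y) (H (s (r i)) (d (Q (t k)))) 0.
  rewrite !subr0 distrC; move: h2 h3; rewrite /=; lra.
have [f1 f1P f1c] := @weakstar_cluster R F (fun i => f (s (r i))) M
  (fun i => fP _) (fun i => fM _).
have f1d q' : f1 (T (d q')) = f0 (T (d q')).
  apply/eqP; rewrite -subr_eq0 -normr_le0; apply/ler_addgt0Pr => e e0; rewrite add0r.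
  have e2 : 0 < e / 2 by rewrite divr_gt0.
  have /subr_cvg0/cvg0P/(_ _ e2)[N hN] := slim q'.
  have [n Nn /(_ _ (mem_head _ _))] := f1c [:: T (d q')] _ N e2.
  have := hN (r n) (leq_trans Nn (leq_increasing rS n)).
  rewrite !ltr_norml ler_norml => /andP[? ?] /andP[? ?].
  by apply/andP; split; lra.
(* Both functionals are limits at [y] of their values on the [T (d (Q (t k)))], where they agree. *)
have f1y : f1 y = f0 y.
  apply: (@norm_cvg_unique _ _ ((fun k => f0 (T (d (Q (t k))))) @ \oo)).
    by have := tP _ f1P; under eq_fun do rewrite f1d.
  exact: tP.
have [n _ /(_ _ (mem_head _ _))] := f1c [:: y] de 0%N de0.
by rewrite f1y ltNge far.
Qed.

End Sequence.
End Adjoint.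
End Operator.

Theorem theorem2p11 (R : realType) (E F : BanachLattice R)
  (hE : AL_space E)
  (hF : order_continuous (dual (vl_of F)))
  (T : blT E -> blT F)
  (hT : @bounded_op R (vl_of E) (vl_of F) T)
  (hc : @seq_uaw_compact R (vl_of E) (vl_of F) T) :
  @seq_uaw_compact R (dual (vl_of F)) (dual (vl_of E))
    (@adjoint R (vl_of E) (vl_of F) T).
Proof.
move=> f fP [M hM].
have fM n x : `|f n x| <= M * `|x|.
  apply: le_trans (dual_norm_ge (fP n) x) _.
  by rewrite ler_wpM2r //; apply: hM.
have [f0 f0P f0c] := weakstar_cluster fP fM.
have [s [sS sP]] := adjoint_subsequence hT hE
  (uaw_compact_weakly_compact hT hF hc) fP fM f0P f0c.
exists s, (@adjoint R (vl_of E) (vl_of F) T f0); split=> //.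
split; first exact: (blin_comp hT f0P).
move=> u uP u0; pose H n := adjoint_diff hT fP f0P (s n).
pose h n := lmeet (dual_lgroup E) (labs (dual_lgroup E) (H n)) (DualT uP).
have hu : lle (dual_lgroup E) 0 (DualT uP) by move=> x; apply: u0.
exists (fun n => dfun (h n)); split=> [n|phi phiP].
  exists (dfun (labs (dual_lgroup E) (H n))); split.
    exact: (dual_labs_is_abs (H n)).
  exact: (dual_lmeet_is_meet _ (DualT uP)).
(* The value of [phi] at [h n] is dominated by [Phi (h n)], hence by the value of [Phi] at the
   modulus of [H n]. *)
have [Phi PhiP [phiPhi [C C0 PhiC]]] := bidual_majorant phiP.
have /cvg0P hlim := sP Phi C PhiP C0 PhiC.
apply/cvg0P => e /hlim[N hN]; exists N => n /hN; apply: le_lt_trans.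
have hn0 : lle (dual_lgroup E) 0 (h n) by apply: lmeet_ge0 => //; apply: labs_ge0.
apply: le_trans (phiPhi _ hn0) (le_trans _ (ler_norm _)).
by apply: (cone_mono PhiP) => //; apply: lmeet_lbl.
Qed.
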